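(* Let $E$ be a compact subset of $\mathbb{D}$ and suppose that $E$ contains a sequence $(a_n)_{n\geq 1}$ of distinct points with $a_n\neq 0$ for all $n\geq 1$, such that $\lim_{n\to\infty} a_n=0$ and such that for all $n\geq 1$ we have $$|a_{n+1}| \geq \frac{1}{2} |a_n| .$$ Suppose that $G=\mathbb{D}\setminus E$ is connected (hence a domain, possibly multiply connected) and that $0\in\partial G$. Then there is a constant $c>0$ such that for all $z\in G$ we have $$\lambda_G(z) \geq \frac{c}{|z|} .$$ Moreover, one may take $$c = \min\left\{ \frac{1}{2\sqrt{2}\left(\kappa+\log\frac{4}{\delta}\right)},\ \frac{1}{2\sqrt{2}\left(\kappa+5\log 2\right)} \right\},$$ where $$\delta=\max\{|a_n| : n\geq 1\}\quad\text{and}\quad \kappa = 4+\log(3+2\sqrt{2}).$$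
   Context: $\mathbb{D}=\{z\in\mathbb{C} : |z|<1\}$ is the open unit disk in the complex plane $\mathbb{C}$, and $\partial G$ denotes the boundary of $G$ in $\mathbb{C}$. For a domain $G\subset\mathbb{C}$ that has a hyperbolic metric (i.e. whose complement in $\mathbb{C}$ contains at least two points), $\lambda_G(z)$, $z\in G$, denotes the density of the hyperbolic metric in $G$, with the normalization under which $\lambda_{\mathbb{D}}(z)=\frac{1}{1-|z|^2}$ for all $z\in\mathbb{D}$; that is, if $p:\mathbb{D}\to G$ is a holomorphic universal covering map, then $\lambda_G(p(w))\,|p'(w)| = \frac{1}{1-|w|^2}$ for all $w\in\mathbb{D}$. $\log$ is the natural logarithm. *)

(* Defs.v *)
From HB Require Import structures.
From mathcomp Require Import all_boot all_order all_algebra.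
From mathcomp Require Import complex.
From mathcomp Require Import all_classical all_reals all_analysis.

Set Implicit Arguments.
Unset Strict Implicit.
Unset Printing Implicit Defensive.

Import Order.TTheory GRing.Theory Num.Theory numFieldNormedType.Exports.
Local Open Scope classical_set_scope.
Local Open Scope ring_scope.

(* The complex field R[i], packed as a [numClosedFieldType]: the topology and
   the normed-module structure of a numeric field are inferred from the
   structure, not from the carrier R[i].  Its norm `|z| is complex-valued; the
   real-valued modulus is [Normc.normc z], with `|z| = (Normc.normc z)%:C. *)
Definition cplx (R : realType) : numClosedFieldType := R[i].
Arguments cplx : simpl never.

Definition unit_disk (R : realType) : set (cplx R) :=
  [set z | Normc.normc z < 1].

Definition boundary (T : topologicalType) (A : set T) : set T :=
  closure A `\` A°.

Definition is_maximum (R : realType) (A : set R) (m : R) : Prop :=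
  A m /\ ubound A m.

Definition homeomorphism_onto (X Y : topologicalType) (V : set X) (U : set Y)
    (p : X -> Y) : Prop :=
  {within V, continuous p} /\
  exists q : Y -> X,
    [/\ {within U, continuous q},
        forall x, V x -> U (p x) /\ q (p x) = x &
        forall y, U y -> V (q y) /\ p (q y) = y].

(* [p] restricts to a covering map from D onto G, for D and G open (so that
   openness in D or in G is openness in the ambient space): every point of G
   has an evenly covered open neighbourhood U, with sheets the members of S. *)
Definition covering_map (X Y : topologicalType) (D : set X) (G : set Y)
    (p : X -> Y) : Prop :=
  [/\ {within D, continuous p},
      p @` D = G &
      forall z, G z -> exists U : set Y,
        [/\ open U, U z, U `<=` G &
            exists S : set (set X),
              [/\ trivIset S id,
                  \bigcup_(V in S) V = D `&` p @^-1` U &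
                  forall V, S V -> open V /\ homeomorphism_onto V U p]]].

Definition holomorphic_on (R : realType) (D : set (cplx R))
    (f : cplx R -> cplx R) : Prop :=
  forall w, D w -> derivable f w 1.

(* The disk is simply connected, so a covering by the disk is universal. *)
Definition holomorphic_universal_covering (R : realType) (G : set (cplx R))
    (p : cplx R -> cplx R) : Prop :=
  holomorphic_on (@unit_disk R) p /\ covering_map (@unit_disk R) G p.

(* [lam] is, on G, the density of the hyperbolic metric of G, normalized by
   1 / (1 - |w|^2) on the unit disk.  The equation determines [lam] on the
   image G of p, and the result does not depend on p since two universal
   coverings of G differ by an automorphism of the disk.  The values of [lam]
   outside G are unconstrained. *)
Definition hyperbolic_density (R : realType) (G : set (cplx R))
    (lam : cplx R -> R) : Prop :=
  exists2 p : cplx R -> cplx R, holomorphic_universal_covering G p &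
    forall w, unit_disk w ->
      lam (p w) * Normc.normc (derive1 p w) = 1 / (1 - Normc.normc w ^+ 2).

Definition kappa (R : realType) : R := 4 + ln (3 + 2 * Num.sqrt 2).

Definition explicit_constant (R : realType) (delta : R) : R :=
  Num.min (1 / (2 * Num.sqrt 2 * (kappa R + ln (4 / delta))))
          (1 / (2 * Num.sqrt 2 * (kappa R + 5 * ln 2))).

(* Main.v *)
Require Import Defs.
From mathcomp Require Import all_boot all_order all_algebra.
From mathcomp Require Import ring lra.
From mathcomp Require Import complex.
From mathcomp Require Import all_classical all_reals all_analysis.
Import Order.TTheory GRing.Theory Num.Theory numFieldNormedType.Exports.
Local Open Scope classical_set_scope.
Local Open Scope ring_scope.
Set Implicit Arguments.
Unset Strict Implicit.
Unset Printing Implicit Defensive.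

(** The value [lam (p w)] is [1 / ((1 - |w|^2) |p' w|)], so the theorem asks for
    an upper bound of [(1 - |w|^2) |p' w| / |p w|], where [p] is holomorphic on
    the disk with values in the complement of [E].

    Look at [p] through the logarithm. Since 0 and the [a n] are omitted, a
    branch [h] of [log p] omits every logarithm of every [a n]. Their real parts
    run from their maximum [ln delta] down to minus infinity with gaps of at most
    [ln 2], and they recur with period [2 pi i]. As [|p| < 1], every value of [h] is
    therefore at distance less than [D = kappa + ln (4 / delta)] from an omitted
    value. A Landau-type theorem, [log_landau], turns this into
    [(1 - |w|^2) |h'| <= 12/5 D], and [12/5 <= 2 sqrt 2].

    That theorem is proved by Ahlfors' method. Put [C = 3 D]. If [b] is an
    omitted value of [h], then [k = sqrt ((h - b) / C)] is holomorphic, and where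
    [|k| < 1] it pulls the hyperbolic metric of the disk back to
    [|h'| / (2 C sqrt t (1 - t))] with [t = |h - b| / C]. This decreases in [t]
    up to [t = 1/3], so the choice of the nearest [b] produces a continuous
    metric, [log_density], that lies above a pull-back at each point and touches
    it there. By [ahlfors_lemma] such a metric is at most the hyperbolic metric,
    and [sqrt t (1 - t) <= 2/5] yields the bound. Only local branches of the
    logarithm and of the root occur, because the distance of [log (p w)] to
    [log E] depends on [p w] alone ([log_dist]).

    Ahlfors' lemma itself comes from the maximum modulus principle. If the metric
    exceeded the hyperbolic metric, then on a slightly smaller disk their ratio
    would have a maximum [m > 1] at an interior point [w0]. The map [k] touching
    the metric there expands hyperbolic lengths by [m] at [w0], hence pushes
    nearby points away from [k w0] in hyperbolic distance, and Pick's identity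
    shows that a function of the form [k' g], with [g] holomorphic, has a strict
    local maximum of its modulus at [w0] ([no_interior_max]).

    What is needed of complex analysis is obtained from mere differentiability.
    Goursat's theorem gives Cauchy's formula on rectangles ([cauchy_formula]).
    Applied to the powers [f ^ n] it gives the maximum modulus principle, the
    constants disappearing in the limit, and it tolerates exceptional points at
    which the function is only continuous ([max_modulus_rect2]). Divided
    differences are functions of this kind, so they are bounded, which makes the
    derivative Lipschitz and the convergence of the difference quotients uniform
    ([slope_lipschitz]); a maximum principle for [f' g] follows
    ([max_modulus_derive]). *)

Local Notation normc := Normc.normc.


(** * Real part, imaginary part and modulus *)

Section Modulus.
Variable R : realType.
Implicit Types (z w a : cplx R) (x y e : R).

(** [cplx R] is [R[i]] under a name that unification keeps apart from it. The
    coordinates and the basic laws of the modulus are stated for [cplx R], so that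
    they rewrite terms of that type. *)
Definition re z : R := complex.Re z.
Arguments re : simpl never.
Definition im z : R := complex.Im z.
Arguments im : simpl never.
Definition mkc x y : cplx R := Complex x y.

Lemma re_mkc x y : re (mkc x y) = x. Proof. by []. Qed.
Lemma im_mkc x y : im (mkc x y) = y. Proof. by []. Qed.
Lemma cplxP z w : re z = re w -> im z = im w -> z = w.
Proof. by case: z => a b; case: w => c d; rewrite /re /im /= => -> ->. Qed.
Lemma mkcE z : z = mkc (re z) (im z). Proof. exact: cplxP. Qed.
Lemma reD z w : re (z + w) = re z + re w. Proof. by case: z; case: w. Qed.
Lemma imD z w : im (z + w) = im z + im w. Proof. by case: z; case: w. Qed.
Lemma reN z : re (- z) = - re z. Proof. by case: z. Qed.
Lemma imN z : im (- z) = - im z. Proof. by case: z. Qed.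
Lemma reB z w : re (z - w) = re z - re w. Proof. by rewrite reD reN. Qed.
Lemma imB z w : im (z - w) = im z - im w. Proof. by rewrite imD imN. Qed.
Lemma reM z w : re (z * w) = re z * re w - im z * im w.
Proof. by case: z; case: w. Qed.
Lemma imM z w : im (z * w) = re z * im w + im z * re w.
Proof. by case: z => a b; case: w. Qed.
Lemma re0 : re 0 = 0. Proof. by []. Qed.
Lemma im0 : im 0 = 0. Proof. by []. Qed.
Lemma re1 : re 1 = 1. Proof. by []. Qed.
Lemma im1 : im 1 = 0. Proof. by []. Qed.
Lemma reV z : re z^-1 = re z / (re z ^+ 2 + im z ^+ 2).
Proof. by case: z. Qed.
Lemma imV z : im z^-1 = - im z / (re z ^+ 2 + im z ^+ 2).
Proof. by case: z => a b /=; rewrite mulNr. Qed.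
Definition reimE := (re_mkc, im_mkc, reD, imD, reN, imN, reM, imM, re0, im0,
  re1, im1).

Lemma normc_reim z : normc z = Num.sqrt (re z ^+ 2 + im z ^+ 2).
Proof. by case: z. Qed.
Lemma normc_norm z : `|z| = ((normc z)%:C)%C :> cplx R.
Proof. by rewrite normc_reim -normc_def. Qed.
Lemma normc_ge0 z : 0 <= normc z. Proof. by rewrite normc_reim sqrtr_ge0. Qed.
Lemma normcM z w : normc (z * w) = normc z * normc w.
Proof. exact: Normc.normcM. Qed.
Lemma normcV z : normc z^-1 = (normc z)^-1.
Proof. exact: Normc.normcV. Qed.
Lemma normcf z w : normc (z / w) = normc z / normc w.
Proof. by rewrite normcM normcV. Qed.
Lemma normcN z : normc (- z) = normc z.
Proof. by rewrite !normc_reim reN imN !sqrrN. Qed.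
Lemma normcD z w : normc (z + w) <= normc z + normc w.
Proof. exact: le_normcD. Qed.
Lemma normcB z w : normc (z - w) <= normc z + normc w.
Proof. by rewrite -(normcN w) normcD. Qed.
Lemma normcC z w : normc (z - w) = normc (w - z).
Proof. by rewrite -normcN opprB. Qed.
Lemma normc_triangle w z a : normc (z - a) <= normc (z - w) + normc (w - a).
Proof. by rewrite -(subrKA w) normcD. Qed.
Lemma normc_tri z w : normc z <= normc w + normc (z - w).
Proof. by rewrite -{1}(subrK w z) addrC normcD. Qed.
Lemma normc0 : normc (0 : cplx R) = 0. Proof. exact: Normc.normc0. Qed.
Lemma normc1 : normc (1 : cplx R) = 1. Proof. exact: Normc.normc1. Qed.
Lemma normcX z n : normc (z ^+ n) = normc z ^+ n.
Proof. by elim: n => [|n IH]; rewrite ?normc1 // !exprS normcM IH. Qed.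
Lemma normc_eq0 z : (normc z == 0) = (z == 0).
Proof.
apply/eqP/eqP => [/Normc.eq0_normc//|->]; exact: normc0.
Qed.
Lemma normc_gt0 z : (0 < normc z) = (z != 0).
Proof. by rewrite lt_def normc_ge0 andbT normc_eq0. Qed.
Lemma sqr_normcE z : normc z ^+ 2 = re z ^+ 2 + im z ^+ 2.
Proof. by rewrite normc_reim sqr_sqrtr // addr_ge0 // sqr_ge0. Qed.
Lemma re_le_normc z : `|re z| <= normc z.
Proof.
rewrite normc_reim -sqrtr_sqr ler_sqrt ?lerDl ?sqr_ge0 //.
by rewrite addr_ge0 // sqr_ge0.
Qed.
Lemma im_le_normc z : `|im z| <= normc z.
Proof.
rewrite normc_reim -sqrtr_sqr ler_sqrt ?lerDr ?sqr_ge0 //.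
by rewrite addr_ge0 // sqr_ge0.
Qed.
Lemma normc_le_reim z : normc z <= `|re z| + `|im z|.
Proof.
rewrite -(@ler_pXn2r _ 2) ?nnegrE ?addr_ge0 ?normc_ge0 // sqr_normcE.
by rewrite sqrrD !real_normK ?num_real // lerD2r lerDl mulrn_wge0 // mulr_ge0.
Qed.
Lemma normc_re x : normc (mkc x 0) = `|x|.
Proof. by rewrite normc_reim /= expr0n addr0 sqrtr_sqr. Qed.

Lemma normc_nat2 : normc (2 : cplx R) = 2.
Proof.
have -> : (2 : cplx R) = mkc 2 0.
  by apply: cplxP; rewrite -[2]/(1 + 1) !reimE ?addr0.
by rewrite normc_re ger0_norm.
Qed.

(** The norm of [cplx R] has values in [cplx R], so its balls have radii in the
    positive reals of [cplx R]; this and the next lemmas move to radii in [R]. *)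
Lemma nbhs_cplxP a (P : cplx R -> Prop) :
  (\forall z \near a, P z) <->
  exists2 e : R, 0 < e & forall z, normc (z - a) < e -> P z.
Proof.
split.
  move=> /nbhs_ballP[e /= e0 He].
  have : (0 : R[i]) < e by exact: e0.
  rewrite ltcE => /andP[/eqP ime re0'].
  exists (re e) => // z hz; apply: He; rewrite -ball_normE /= .
  rewrite normc_norm normcC.
  rewrite (mkcE e) (_ : im e = 0); last by rewrite /im ime.
  by rewrite /mkc -[X in _ < X]/((re e)%:C)%C ltcR.
move=> [e e0 He]; apply/nbhs_ballP; exists ((e%:C)%C : cplx R) => /=.
  by rewrite -[0]/((0%:C)%C : cplx R) ltcR.
move=> z; rewrite -ball_normE /= normc_norm ltcR normcC => hz; exact: He.
Qed.

Lemma continuous_cplxP (f : cplx R -> cplx R) a : {for a, continuous f} <->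
  forall e, 0 < e -> exists2 d : R, 0 < d &
    forall z, normc (z - a) < d -> normc (f z - f a) < e.
Proof.
split=> [cf e e0|H P].
  have /cf : nbhs (f a) [set w | normc (w - f a) < e].
    by apply/nbhs_cplxP; exists e.
  by move=> /nbhs_cplxP.
rewrite -[nbhs (f a) P]/(\forall z \near f a, P z) => /nbhs_cplxP[e e0 He].
have [d d0 Hd] := H _ e0.
apply/nbhs_cplxP; exists d => // z hz; apply: He; exact: Hd.
Qed.

Lemma continuous_cplx_realP (f : cplx R -> R) a : {for a, continuous f} <->
  forall e, 0 < e -> exists2 d : R, 0 < d &
    forall z, normc (z - a) < d -> `|f z - f a| < e.
Proof.
split=> [cf e e0|H P].
  have /cf : nbhs (f a) [set w | `|w - f a| < e].
    by apply/nbhs_ballP; exists e => // w; rewrite /ball /= distrC.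
  by move=> /nbhs_cplxP.
move/nbhs_ballP=> [e /= e0 He].
have [d d0 Hd] := H _ e0.
apply/nbhs_cplxP; exists d => // z hz; apply: He.
by rewrite /ball /= distrC; exact: Hd.
Qed.

Lemma continuous_normc : continuous (@normc R : cplx R -> R).
Proof.
move=> a; apply/continuous_cplx_realP => e e0; exists e => // z hz.
apply: le_lt_trans hz; rewrite ler_norml; have := normc_tri z a.
have := normc_tri a z; rewrite normcC; lra.
Qed.
Lemma continuous_re : continuous re.
Proof.
move=> a; apply/continuous_cplx_realP => e e0; exists e => // z hz.
by apply: le_lt_trans hz; rewrite -reB re_le_normc.
Qed.
Lemma continuous_im : continuous im.
Proof.
move=> a; apply/continuous_cplx_realP => e e0; exists e => // z hz.
by apply: le_lt_trans hz; rewrite -imB im_le_normc.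
Qed.
End Modulus.
Arguments re : simpl never.
Arguments im : simpl never.


(** * Complex differentiability *)

Section Derivative.
Variable R : realType.
Implicit Types (z w a c l : cplx R) (x y e : R) (f g : cplx R -> cplx R).

Lemma is_derive_cplxP f a l : is_derive a (1 : cplx R) f l <->
  forall e, 0 < e -> exists2 d : R, 0 < d &
    forall z, normc (z - a) < d ->
      normc (f z - f a - l * (z - a)) <= e * normc (z - a).
Proof.
pose q (h : cplx R) : cplx R := h^-1 *: ((f \o shift a) (h *: 1) - f a).
have qE z : z != a -> q (z - a) - l = (f z - f a - l * (z - a)) / (z - a).
  rewrite -subr_eq0 => za; rewrite /q /= scaler1 subrK.
  rewrite mulrBl mulfK //; congr (_ - _); exact: mulrC.
have cvgP : (q @ 0^' --> l) <-> forall e, 0 < e -> exists2 d : R, 0 < d &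
    forall z, normc (z - a) < d ->
      normc (f z - f a - l * (z - a)) <= e * normc (z - a).
  split=> [cq e e0|H].
    have /cq : nbhs l [set w | normc (w - l) < e].
      by apply/nbhs_cplxP; exists e.
    move/nbhs_cplxP=> [d d0 Hd]; exists d => // z hz.
    have [->|za] := eqVneq z a.
      by rewrite !subrr mulr0 subrr normc0 mulr0.
    have := Hd (z - a); rewrite subr0 => /(_ hz).
    have za' : z - a != 0 by rewrite subr_eq0.
    move=> /(_ za') /=; rewrite qE // normcf.
    by rewrite ltr_pdivrMr ?normc_gt0 ?subr_eq0 // => /ltW.
  move=> P /nbhs_cplxP[e e0 He].
  have e2 : 0 < e / 2 by lra.
  have [d d0 Hd] := H _ e2.
  apply/nbhs_cplxP; exists d => // h; rewrite subr0 => hd h0.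
  apply: He; have := qE (h + a); rewrite addrK => ->; last first.
    by rewrite -subr_eq0 addrK.
  rewrite normcf; have := Hd (h + a); rewrite addrK => /(_ hd) H1.
  have n0 : 0 < normc h by rewrite normc_gt0.
  rewrite ltr_pdivrMr //; apply: le_lt_trans H1 _.
  by rewrite ltr_pM2r // ltr_pdivrMr //; lra.
rewrite -cvgP; split=> [[df dl]|cq].
  rewrite -dl; exact: df.
apply: DeriveDef; first by apply/cvg_ex; exists l.
apply: cvg_lim => //; exact: norm_hausdorff.
Qed.

(** Differentiability at [a] is continuity of the divided difference with the
    derivative filled in at [a] (Caratheodory). In this form the chain rule and
    the rule for inverses are algebra. *)
Lemma is_derive_slope f a l : is_derive a (1 : cplx R) f l ->
  {for a, continuous (fun z => if z == a then l else (f z - f a) / (z - a))}.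
Proof.
move/is_derive_cplxP=> H; apply/continuous_cplxP => e e0.
have e2 : 0 < e / 2 by lra.
have [d d0 Hd] := H _ e2; exists d => // z hz.
rewrite /= eqxx; have [_|za] := eqVneq z a; first by rewrite subrr normc0.
have za0 : z - a != 0 by rewrite subr_eq0.
have -> : (f z - f a) / (z - a) - l = (f z - f a - l * (z - a)) / (z - a).
  by rewrite [RHS]mulrBl mulfK.
rewrite normcf ltr_pdivrMr ?normc_gt0 //; apply: le_lt_trans (Hd _ hz) _.
by rewrite ltr_pM2r ?normc_gt0 // ltr_pdivrMr //; lra.
Qed.

Lemma is_derive_caratheodory f g a :
  (forall z, f z - f a = g z * (z - a)) -> {for a, continuous g} ->
  is_derive a (1 : cplx R) f (g a).
Proof.
move=> fg /continuous_cplxP cg; apply/is_derive_cplxP => e e0.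
have [d d0 Hd] := cg _ e0; exists d => // z /Hd hz.
rewrite fg -mulrBl normcM ler_wpM2r ?normc_ge0 //; exact: ltW.
Qed.

Lemma derivable_caratheodory f a : derivable f a 1 ->
  exists2 g, (forall z, f z - f a = g z * (z - a)) & {for a, continuous g} /\
  g a = 'D_1 f a.
Proof.
move=> /derivableP/is_derive_slope cs.
eexists; last by split; [exact: cs|rewrite /= eqxx].
move=> z /=; have [->|za] := eqVneq z a; first by rewrite !subrr mulr0.
by rewrite divfK // subr_eq0.
Qed.

Lemma cplx_derivable_continuous f a : derivable f a 1 -> {for a, continuous f}.
Proof. by move=> /derivable1_diffP/differentiable_continuous. Qed.

Lemma is_derive_cmul f a l c : is_derive a (1 : cplx R) f l ->
  is_derive a (1 : cplx R) (fun z => c * f z) (c * l).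
Proof.
move=> df; have [q fq [cq qa]] :=
  derivable_caratheodory (@ex_derive _ _ _ _ _ _ _ df).
have <- : 'D_1 f a = l by exact: derive_val.
rewrite -qa; have hE z : c * f z - c * f a = (c * q z) * (z - a).
  by rewrite -mulrBr fq mulrA.
apply: (is_derive_caratheodory hE).
by apply: (@continuousM _ _ (cst c) q); [exact: cst_continuous|exact: cq].
Qed.

Lemma is_derive_cplx_comp f g a k l :
  is_derive a (1 : cplx R) f k -> is_derive (f a) (1 : cplx R) g l ->
  is_derive a (1 : cplx R) (g \o f) (l * k).
Proof.
move=> df dg.
have [p fp [cp pa]] :=
  derivable_caratheodory (@ex_derive _ _ _ _ _ _ _ df).
have [q gq [cq qa]] :=
  derivable_caratheodory (@ex_derive _ _ _ _ _ _ _ dg).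
have <- : 'D_1 f a = k by exact: derive_val.
have <- : 'D_1 g (f a) = l by exact: derive_val.
rewrite -pa -qa; pose h z := q (f z) * p z.
have hE z : (g \o f) z - (g \o f) a = h z * (z - a).
  by rewrite /= gq fp mulrA.
apply: (is_derive_caratheodory hE).
apply: (@continuousM _ _ (q \o f) p); last exact: cp.
apply: continuous_comp; last exact: cq.
apply: cplx_derivable_continuous; exact: (@ex_derive _ _ _ _ _ _ _ df).
Qed.

Lemma derivable_cplx_comp f g a :
  derivable f a 1 -> derivable g (f a) 1 -> derivable (g \o f) a 1.
Proof.
move=> /derivableP df /derivableP dg.
exact: (@ex_derive _ _ _ _ _ _ _ (is_derive_cplx_comp df dg)).
Qed.

End Derivative.


(** * Integrals along segments and rectangles *)

Section SegmentIntegral.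
Variable R : realType.
Implicit Types (g h : R -> cplx R) (a b c : R).
Local Notation mu := lebesgue_measure.

Definition cont_seg g a b := forall x, a <= x <= b ->
  {for x, continuous (fun t => re (g t))} /\
  {for x, continuous (fun t => im (g t))}.

Definition seg_int g a b : cplx R :=
  mkc (\int[mu]_(x in `[a, b]) re (g x)) (\int[mu]_(x in `[a, b]) im (g x)).

Lemma continuous_seg_integrable (f : R -> R) a b :
  (forall x, a <= x <= b -> {for x, continuous f}) ->
  mu.-integrable `[a, b] (EFin \o f).
Proof.
move=> cf; apply: continuous_compact_integrable; first exact: segment_compact.
apply: continuous_in_subspaceT => x; rewrite inE /= in_itv /= => /cf; exact.
Qed.

Lemma cont_seg_re g a b : cont_seg g a b ->
  mu.-integrable `[a, b] (EFin \o (fun x => re (g x))).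
Proof. by move=> cg; apply: continuous_seg_integrable => x /cg[]. Qed.

Lemma cont_seg_im g a b : cont_seg g a b ->
  mu.-integrable `[a, b] (EFin \o (fun x => im (g x))).
Proof. by move=> cg; apply: continuous_seg_integrable => x /cg[]. Qed.

Lemma seg_intD g h a b : cont_seg g a b -> cont_seg h a b ->
  seg_int (fun x => g x + h x) a b = seg_int g a b + seg_int h a b.
Proof.
move=> cg ch; apply: cplxP; rewrite !(reimE) /=.
  under eq_Rintegral do rewrite reD.
  by rewrite RintegralD //; exact: cont_seg_re.
under eq_Rintegral do rewrite imD.
by rewrite RintegralD //; exact: cont_seg_im.
Qed.

Lemma seg_intZ g a b (k : cplx R) : cont_seg g a b ->
  seg_int (fun x => k * g x) a b = k * seg_int g a b.
Proof.
move=> cg; have ir := cont_seg_re cg; have ii := cont_seg_im cg.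
have Zre r : mu.-integrable `[a, b] (EFin \o (fun x => r * re (g x))).
  apply: continuous_seg_integrable => x /cg[cr _].
  by apply: continuousM; [exact: cvg_cst|exact: cr].
have Zim r : mu.-integrable `[a, b] (EFin \o (fun x => r * im (g x))).
  apply: continuous_seg_integrable => x /cg[_ ci].
  by apply: continuousM; [exact: cvg_cst|exact: ci].
apply: cplxP; rewrite !(reimE) /=.
  under eq_Rintegral do rewrite reM.
  by rewrite RintegralB ?RintegralZl.
under eq_Rintegral do rewrite imM.
by rewrite RintegralD ?RintegralZl.
Qed.

Lemma seg_int_cst (k : cplx R) a b : a <= b ->
  seg_int (fun=> k) a b = k * mkc (b - a) 0.
Proof.
move=> ab; rewrite /seg_int !Rintegral_cst //= lebesgue_measure_itv /=.
rewrite lte_fin; have [ab'|ba] := ltP a b.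
  by apply: cplxP; rewrite !reimE /=; ring.
have -> : a = b by apply/eqP; rewrite eq_le ab.
by apply: cplxP; rewrite !reimE /=; ring.
Qed.

Lemma Rintegral_seg_split (f : R -> R) a c b : a <= c -> c <= b ->
  (forall x, a <= x <= b -> {for x, continuous f}) ->
  \int[mu]_(x in `[a, b]) f x =
  \int[mu]_(x in `[a, c]) f x + \int[mu]_(x in `[c, b]) f x.
Proof.
move=> ac cb cf; have fi := continuous_seg_integrable cf.
have := @Rintegral_itvB _ f (BLeft a) (BRight b) c fi; rewrite !bnd_simp.
move=> /(_ ac cb); rewrite (@Rintegral_itv_obnd_cbnd _ c (BRight b) f).
  by move=> <-; rewrite addrC subrK.
apply: integrableS fi => //; apply: subset_itvr; rewrite bnd_simp //.
Qed.

Lemma seg_int_split g a c b : a <= c -> c <= b -> cont_seg g a b ->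
  seg_int g a b = seg_int g a c + seg_int g c b.
Proof.
move=> ac cb cg; apply: cplxP; rewrite reimE /=.
  by apply: Rintegral_seg_split => // x /cg[].
by apply: Rintegral_seg_split => // x /cg[].
Qed.

Lemma Rintegral_seg_ge (f : R -> R) m a b : a <= b ->
  (forall x, a <= x <= b -> {for x, continuous f}) ->
  (forall x, a <= x <= b -> m <= f x) ->
  m * (b - a) <= \int[mu]_(x in `[a, b]) f x.
Proof.
move=> ab cf mf; have fi := continuous_seg_integrable cf.
apply: (@le_trans _ _ (\int[mu]_(x in `[a, b]) (fun=> m) x)).
  rewrite Rintegral_cst //= lebesgue_measure_itv /= lte_fin.
  have [ab'|ba] := ltP a b; first by [].
  by rewrite mulr0 (_ : b - a = 0) ?mulr0 //; lra.
apply: le_Rintegral => //.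
by apply: continuous_seg_integrable => x _; exact: cvg_cst.
Qed.

Lemma Rintegral_seg_le (f : R -> R) m a b : a <= b ->
  (forall x, a <= x <= b -> {for x, continuous f}) ->
  (forall x, a <= x <= b -> f x <= m) ->
  \int[mu]_(x in `[a, b]) f x <= m * (b - a).
Proof.
move=> ab cf mf; have fi := continuous_seg_integrable cf.
apply: (@le_trans _ _ (\int[mu]_(x in `[a, b]) (fun=> m) x)).
  apply: le_Rintegral => //.
  by apply: continuous_seg_integrable => x _; exact: cvg_cst.
rewrite Rintegral_cst //= lebesgue_measure_itv /= lte_fin.
have [ab'|ba] := ltP a b; first by [].
by rewrite mulr0 (_ : b - a = 0) ?mulr0 //; lra.
Qed.

Lemma Rintegral_seg_bound (f : R -> R) M a b : a <= b ->
  (forall x, a <= x <= b -> {for x, continuous f}) ->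
  (forall x, a <= x <= b -> `|f x| <= M) ->
  `|\int[mu]_(x in `[a, b]) f x| <= M * (b - a).
Proof.
move=> ab cf fM; rewrite ler_norml -mulNr; apply/andP; split.
  by apply: Rintegral_seg_ge => // x /fM; rewrite ler_norml => /andP[].
by apply: Rintegral_seg_le => // x /fM; exact: le_trans (ler_norm _).
Qed.

(** The factor 2 comes from bounding real and imaginary parts separately. It is
    harmless: the estimates are used up to a constant. *)
Lemma seg_int_bound g M a b : a <= b -> cont_seg g a b ->
  (forall x, a <= x <= b -> normc (g x) <= M) ->
  normc (seg_int g a b) <= 2 * M * (b - a).
Proof.
move=> ab cg gM; apply: le_trans (normc_le_reim _) _; rewrite !reimE.
rewrite -mulrA mulr_natl mulr2n; apply: lerD; apply: Rintegral_seg_bound => //.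
- by move=> x /cg[].
- by move=> x /gM; exact: le_trans (re_le_normc _).
- by move=> x /cg[].
- by move=> x /gM; exact: le_trans (im_le_normc _).
Qed.

End SegmentIntegral.


Section RectangleIntegral.
Variable R : realType.
Implicit Types (f g : cplx R -> cplx R) (x y : R).

Local Notation II := (mkc 0 1 : cplx R).

Lemma continuous_hline f x y : {for mkc x y, continuous f} ->
  {for x, continuous (fun t => re (f (mkc t y)))} /\
  {for x, continuous (fun t => im (f (mkc t y)))}.
Proof.
move=> cf; have cl : {for x, continuous (fun t => f (mkc t y))}.
  apply: (@continuous_comp _ _ _ (fun t => mkc t y) f); last exact: cf.
  move=> P /nbhs_cplxP[e e0 He]; apply/nbhs_ballP; exists e => // t.
  rewrite /ball /= => xt; apply: He.
  have -> : mkc t y - mkc x y = mkc (t - x) 0.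
    by apply: cplxP; rewrite !reimE; ring.
  by rewrite normc_re distrC.
split.
  exact: (@continuous_comp _ _ _ _ (@re R) x cl (@continuous_re R _)).
exact: (@continuous_comp _ _ _ _ (@im R) x cl (@continuous_im R _)).
Qed.

Lemma continuous_vline f x y : {for mkc x y, continuous f} ->
  {for y, continuous (fun t => re (f (mkc x t)))} /\
  {for y, continuous (fun t => im (f (mkc x t)))}.
Proof.
move=> cf; have cl : {for y, continuous (fun t => f (mkc x t))}.
  apply: (@continuous_comp _ _ _ (fun t => mkc x t) f); last exact: cf.
  move=> P /nbhs_cplxP[e e0 He]; apply/nbhs_ballP; exists e => // t.
  rewrite /ball /= => xt; apply: He; apply: le_lt_trans (normc_le_reim _) _.
  by rewrite !reimE subrr normr0 add0r distrC.
split.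
  exact: (@continuous_comp _ _ _ _ (@re R) y cl (@continuous_re R _)).
exact: (@continuous_comp _ _ _ _ (@im R) y cl (@continuous_im R _)).
Qed.

Definition cont_hline f y x0 x1 :=
  forall x, x0 <= x <= x1 -> {for mkc x y, continuous f}.
Definition cont_vline f x y0 y1 :=
  forall y, y0 <= y <= y1 -> {for mkc x y, continuous f}.

Lemma cont_hline_seg f y x0 x1 : cont_hline f y x0 x1 ->
  cont_seg (fun t => f (mkc t y)) x0 x1.
Proof. by move=> cf x /cf/continuous_hline. Qed.
Lemma cont_vline_seg f x y0 y1 : cont_vline f x y0 y1 ->
  cont_seg (fun t => f (mkc x t)) y0 y1.
Proof. by move=> cf y /cf/continuous_vline. Qed.

(** Counterclockwise integral of [f z dz] over the boundary of a rectangle. *)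
Definition rect_int f x0 x1 y0 y1 : cplx R :=
  seg_int (fun x => f (mkc x y0)) x0 x1 -
  seg_int (fun x => f (mkc x y1)) x0 x1 +
  II * (seg_int (fun y => f (mkc x1 y)) y0 y1 -
        seg_int (fun y => f (mkc x0 y)) y0 y1).

Definition cont_bd f x0 x1 y0 y1 :=
  [/\ cont_hline f y0 x0 x1, cont_hline f y1 x0 x1,
      cont_vline f x0 y0 y1 & cont_vline f x1 y0 y1].

Definition rect x0 x1 y0 y1 : set (cplx R) :=
  [set z | x0 <= re z <= x1 /\ y0 <= im z <= y1].
Definition rect_bd x0 x1 y0 y1 : set (cplx R) :=
  [set z | rect x0 x1 y0 y1 z /\
           [\/ re z = x0, re z = x1, im z = y0 | im z = y1]].

Lemma rect_int_splitx f x0 c x1 y0 y1 : x0 <= c -> c <= x1 ->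
  cont_bd f x0 x1 y0 y1 ->
  rect_int f x0 x1 y0 y1 = rect_int f x0 c y0 y1 + rect_int f c x1 y0 y1.
Proof.
move=> xc cx [/cont_hline_seg h0 /cont_hline_seg h1 _ _].
by rewrite /rect_int (seg_int_split xc cx h0) (seg_int_split xc cx h1); ring.
Qed.

Lemma rect_int_splity f x0 x1 y0 c y1 : y0 <= c -> c <= y1 ->
  cont_bd f x0 x1 y0 y1 ->
  rect_int f x0 x1 y0 y1 = rect_int f x0 x1 y0 c + rect_int f x0 x1 c y1.
Proof.
move=> yc cy [_ _ /cont_vline_seg h0 /cont_vline_seg h1].
by rewrite /rect_int (seg_int_split yc cy h0) (seg_int_split yc cy h1); ring.
Qed.

Lemma rect_intD f g x0 x1 y0 y1 :
  cont_bd f x0 x1 y0 y1 -> cont_bd g x0 x1 y0 y1 ->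
  rect_int (fun z => f z + g z) x0 x1 y0 y1 =
  rect_int f x0 x1 y0 y1 + rect_int g x0 x1 y0 y1.
Proof.
move=> [/cont_hline_seg f0 /cont_hline_seg f1].
move=> /cont_vline_seg f2 /cont_vline_seg f3.
move=> [/cont_hline_seg g0 /cont_hline_seg g1].
move=> /cont_vline_seg g2 /cont_vline_seg g3.
by rewrite /rect_int !seg_intD //; ring.
Qed.

Lemma rect_intZ f (k : cplx R) x0 x1 y0 y1 : cont_bd f x0 x1 y0 y1 ->
  rect_int (fun z => k * f z) x0 x1 y0 y1 = k * rect_int f x0 x1 y0 y1.
Proof.
move=> [/cont_hline_seg f0 /cont_hline_seg f1].
move=> /cont_vline_seg f2 /cont_vline_seg f3.
by rewrite /rect_int !seg_intZ //; ring.
Qed.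

Lemma rect_int_bound f M x0 x1 y0 y1 : x0 <= x1 -> y0 <= y1 ->
  cont_bd f x0 x1 y0 y1 ->
  (forall z, rect_bd x0 x1 y0 y1 z -> normc (f z) <= M) ->
  normc (rect_int f x0 x1 y0 y1) <= 4 * M * (x1 - x0 + (y1 - y0)).
Proof.
move=> x01 y01 [/cont_hline_seg f0 /cont_hline_seg f1].
move=> /cont_vline_seg f2 /cont_vline_seg f3 fM.
apply: le_trans (normcD _ _) _; rewrite normcM.
have -> : normc II = 1 by rewrite normc_reim /= expr0n expr1n add0r sqrtr1.
have := normcB (seg_int (fun x => f (mkc x y0)) x0 x1)
  (seg_int (fun x => f (mkc x y1)) x0 x1).
have := normcB (seg_int (fun y => f (mkc x1 y)) y0 y1)
  (seg_int (fun y => f (mkc x0 y)) y0 y1).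
have H0 : normc (seg_int (fun x => f (mkc x y0)) x0 x1) <= 2 * M * (x1 - x0).
  apply: seg_int_bound => // x hx; apply: fM; split; last by constructor 3.
  by split=> //=; rewrite lexx.
have H1 : normc (seg_int (fun x => f (mkc x y1)) x0 x1) <= 2 * M * (x1 - x0).
  apply: seg_int_bound => // x hx; apply: fM; split; last by constructor 4.
  by split=> //=; rewrite lexx andbT.
have H2 : normc (seg_int (fun y => f (mkc x0 y)) y0 y1) <= 2 * M * (y1 - y0).
  apply: seg_int_bound => // x hx; apply: fM; split; last by constructor 1.
  by split=> //=; rewrite lexx.
have H3 : normc (seg_int (fun y => f (mkc x1 y)) y0 y1) <= 2 * M * (y1 - y0).
  apply: seg_int_bound => // x hx; apply: fM; split; last by constructor 2.
  by split=> //=; rewrite lexx andbT.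
lra.
Qed.

(** Opposite sides differ by a translation, along which an affine function
    changes by a constant; the two constants contributed by the two pairs of
    sides cancel. *)
Lemma rect_int_affine (k l : cplx R) x0 x1 y0 y1 : x0 <= x1 -> y0 <= y1 ->
  rect_int (fun z => k + l * z) x0 x1 y0 y1 = 0.
Proof.
move=> x01 y01.
pose A (z : cplx R) := k + l * z.
have cA z : {for z, continuous A}.
  apply: (@continuousD _ _ _ (cst k) (fun z => l * z)).
    exact: cst_continuous.
  apply: (@continuousM _ _ (cst l) id); first exact: cst_continuous.
  exact: cvg_id.
have diff (g h : R -> cplx R) (d : cplx R) a b : a <= b ->
    cont_seg g a b -> cont_seg h a b -> (forall t, g t = d + h t) ->
    seg_int g a b - seg_int h a b = d * mkc (b - a) 0.
  move=> ab cg ch E; have -> : g = fun t => d + h t by exact/funext.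
  rewrite seg_intD ?addrK ?seg_int_cst //.
  by move=> x _; split; exact: cvg_cst.
rewrite /rect_int (diff _ _ (l * mkc 0 (y0 - y1))) //; last first.
- by move=> t; apply: cplxP; rewrite !reimE; ring.
- by apply: (@cont_hline_seg A) => x _; exact: cA.
- by apply: (@cont_hline_seg A) => x _; exact: cA.
rewrite (diff _ _ (l * mkc (x1 - x0) 0)) //; last first.
- by move=> t; apply: cplxP; rewrite !reimE; ring.
- by apply: (@cont_vline_seg A) => x _; exact: cA.
- by apply: (@cont_vline_seg A) => x _; exact: cA.
by apply: cplxP; rewrite !reimE; ring.
Qed.

End RectangleIntegral.


(** * Goursat's theorem *)

Section Goursat.
Variable R : realType.
Implicit Types (f g : cplx R -> cplx R) (x y : R).

Lemma exp2_half_lt (S d : R) : 0 < d -> exists n, S / 2 ^+ n < d.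
Proof.
move=> d0; have := archi_boundP (normr_ge0 (S / d)).
set n := Num.bound _ => Hn; exists n.
rewrite ltr_pdivrMr ?exprn_gt0 // mulrC -ltr_pdivrMr //.
apply: le_lt_trans (ler_norm _) _; apply: lt_trans Hn _.
by rewrite -natrX ltr_nat ltn_expl.
Qed.

(** The segments [[u n, u n + v n]] are nested; the supremum of the left ends is
    a common point. *)
Lemma nested_segments (u v : nat -> R) : (forall n, 0 <= v n) ->
  (forall n, u n <= u n.+1) -> (forall n, u n.+1 + v n.+1 <= u n + v n) ->
  exists X, forall n, u n <= X <= u n + v n.
Proof.
move=> v0 uS uvS.
have um : {homo u : m n / (m <= n)%N >-> m <= n} by apply/nondecreasing_seqP.
have uvm m n : (m <= n)%N -> u n + v n <= u m + v m.
  elim: n => [|n IH]; first by rewrite leqn0 => /eqP ->.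
  by rewrite leq_eqVlt => /predU1P[-> //|/IH]; apply: le_trans.
have H n m : u n <= u m + v m.
  have [nm|/ltnW mn] := leqP n m.
    by apply: le_trans (um _ _ nm) _; rewrite lerDl.
  by apply: le_trans (uvm _ _ mn); rewrite lerDl.
have hs : has_sup (range u).
  by split; [exists (u 0%N), 0%N|exists (u 0%N + v 0%N) => _ [n _ <-]].
exists (sup (range u)) => n; apply/andP; split.
  by apply: (sup_upper_bound hs); exists n.
by apply: ge_sup => [|_ [m _ <-]] //; exists (u 0%N), 0%N.
Qed.

Lemma cont_bd_of_rect f x0 x1 y0 y1 :
  x0 <= x1 -> y0 <= y1 ->
  (forall z, rect x0 x1 y0 y1 z -> {for z, continuous f}) ->
  cont_bd f x0 x1 y0 y1.
Proof.
by move=> x01 y01 cf; split=> t ht; apply: cf; split; rewrite !reimE ?lexx //=;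
  rewrite ?x01 ?y01.
Qed.

Lemma sub_rect a0 a1 b0 b1 x0 x1 y0 y1 :
  x0 <= a0 -> a1 <= x1 -> y0 <= b0 -> b1 <= y1 ->
  rect a0 a1 b0 b1 `<=` (rect x0 x1 y0 y1 : set (cplx R)).
Proof. move=> xa ax yb bY z [/andP[? ?] /andP[? ?]]; split; lra. Qed.

Lemma le_sum4 (I a b c d : R) : I <= a + b + (c + d) ->
  [\/ I <= 4 * a, I <= 4 * b, I <= 4 * c | I <= 4 * d].
Proof.
have [?|?] := leP I (4 * a); first by constructor 1.
have [?|?] := leP I (4 * b); first by constructor 2.
have [?|?] := leP I (4 * c); first by constructor 3.
have [?|?] := leP I (4 * d); first by constructor 4.
lra.
Qed.

Lemma rect_int_quadrisect f x y (w h : R) : 0 <= w -> 0 <= h ->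
  (forall z, rect x (x + w) y (y + h) z -> {for z, continuous f}) ->
  exists c : R * R,
  [/\ normc (rect_int f x (x + w) y (y + h)) <=
        4 * normc (rect_int f c.1 (c.1 + w / 2) c.2 (c.2 + h / 2)),
      x <= c.1, c.1 + w / 2 <= x + w, y <= c.2 & c.2 + h / 2 <= y + h].
Proof.
move=> w0 h0 cf.
have sub a0 a1 b0 b1 : x <= a0 -> a0 <= a1 -> a1 <= x + w ->
    y <= b0 -> b0 <= b1 -> b1 <= y + h -> cont_bd f a0 a1 b0 b1.
  move=> ? u ? ? v ?; apply: (cont_bd_of_rect u v) => z hz; apply: cf.
  by apply: sub_rect hz.
pose J (c : R * R) := rect_int f c.1 (c.1 + w / 2) c.2 (c.2 + h / 2).
pose c0 := (x, y); pose c1 := (x + w / 2, y).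
pose c2 := (x, y + h / 2); pose c3 := (x + w / 2, y + h / 2).
have E : rect_int f x (x + w) y (y + h) = J c0 + J c2 + (J c1 + J c3).
  have xE : x + w / 2 + w / 2 = x + w by lra.
  have yE : y + h / 2 + h / 2 = y + h by lra.
  rewrite (@rect_int_splitx _ _ _ (x + w / 2)); [|lra|lra|apply: sub; lra].
  rewrite (@rect_int_splity _ _ _ (x + w / 2) _ (y + h / 2));
    [|lra|lra|apply: sub; lra].
  rewrite (@rect_int_splity _ _ _ (x + w) _ (y + h / 2));
    [|lra|lra|apply: sub; lra].
  by rewrite /J /= xE yE.
have {}E : normc (rect_int f x (x + w) y (y + h)) <=
    normc (J c0) + normc (J c2) + (normc (J c1) + normc (J c3)).
  by rewrite E; apply: le_trans (normcD _ _) _; apply: lerD; exact: normcD.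
have xw : x <= x + w / 2 by clear -w0; lra.
have xw' : x + w / 2 <= x + w by clear -w0; lra.
have xw'' : x + w / 2 + w / 2 <= x + w by clear; lra.
have yh : y <= y + h / 2 by clear -h0; lra.
have yh' : y + h / 2 <= y + h by clear -h0; lra.
have yh'' : y + h / 2 + h / 2 <= y + h by clear; lra.
by case: (le_sum4 E) => H;
  [exists c0|exists c2|exists c1|exists c3]; split.
Qed.

(** Quadrisection. Keeping a quarter whose integral is at least a quarter of the
    previous one loses a factor [4 ^ n] after [n] steps. At the common point [p]
    of the nested rectangles [f] is affine up to [e |z - p|], affine functions
    have integral 0, and the remaining integral is at most [e] times perimeter
    times diameter, which regains the factor [4 ^ n]. *)
Theorem goursat f x0 x1 y0 y1 : x0 <= x1 -> y0 <= y1 ->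
  (forall z, rect x0 x1 y0 y1 z -> derivable f z 1) ->
  rect_int f x0 x1 y0 y1 = 0.
Proof.
move=> x01 y01 df.
have cf z : rect x0 x1 y0 y1 z -> {for z, continuous f}.
  by move=> /df; exact: cplx_derivable_continuous.
pose W := x1 - x0; pose H := y1 - y0.
have W0 : 0 <= W by rewrite subr_ge0.
have H0 : 0 <= H by rewrite subr_ge0.
have p2 n : 0 < 2 ^+ n :> R by rewrite exprn_gt0.
pose w n := W / 2 ^+ n; pose h n := H / 2 ^+ n.
have w0 n : 0 <= w n by rewrite divr_ge0 // ltW.
have h0 n : 0 <= h n by rewrite divr_ge0 // ltW.
have wS n : w n / 2 = w n.+1.
  by rewrite /w exprS invfM mulrCA mulrC.
have hS n : h n / 2 = h n.+1.
  by rewrite /h exprS invfM mulrCA mulrC.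
pose J n (c : R * R) := normc (rect_int f c.1 (c.1 + w n) c.2 (c.2 + h n)).
pose good n (c : R * R) :=
  [/\ x0 <= c.1, c.1 + w n <= x1, y0 <= c.2 & c.2 + h n <= y1].
have /choice[F HF] : forall p : nat * (R * R), exists c : R * R,
    good p.1 p.2 -> [/\ good p.1.+1 c, J p.1 p.2 <= 4 * J p.1.+1 c,
      p.2.1 <= c.1, c.1 + w p.1.+1 <= p.2.1 + w p.1 &
      p.2.2 <= c.2 /\ c.2 + h p.1.+1 <= p.2.2 + h p.1].
  move=> [n [x y]] /=; have [g|ng] := EM (good n (x, y)); last by exists (x, y).
  have [/= g1 g2 g3 g4] := g.
  have [|c] := @rect_int_quadrisect f x y (w n) (h n) (w0 n) (h0 n).
    by move=> z hz; apply: cf; apply: sub_rect hz.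
  rewrite wS hS => -[c1 c2 c3 c4 c5]; exists c => _; split=> //.
  by split; lra.
(* [F] selects the next corner; [s n] is the lower left corner at step [n] *)
pose s := fix s n := if n is m.+1 then F (m, s m) else (x0, y0).
have sg n : good n (s n).
  elim: n => [|n IH]; last by have [] := HF (n, s n) IH.
  by rewrite /good /= /w /h expr0 !divr1 /W /H; split; lra.
have sP n := HF (n, s n) (sg n).
have [X HX] : exists X, forall n, (s n).1 <= X <= (s n).1 + w n.
  by apply: nested_segments => // n; have [] := sP n.
have [Y HY] : exists Y, forall n, (s n).2 <= Y <= (s n).2 + h n.
  by apply: nested_segments => // n; have [_ _ _ _ []] := sP n.
have JE n : J 0%N (s 0%N) <= (2 ^+ n) ^+ 2 * J n (s n).
  elim: n => [|n IH]; first by rewrite expr0 expr1n mul1r.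
  apply: le_trans IH _; have [_ /= Jn _ _ _] := sP n.
  rewrite [leRHS](_ : _ = (2 ^+ n) ^+ 2 * (4 * J n.+1 (s n.+1))).
    by rewrite ler_wpM2l ?sqr_ge0.
  by rewrite (exprS 2 n); ring.
have -> : rect_int f x0 x1 y0 y1 = rect_int f x0 (x0 + w 0%N) y0 (y0 + h 0%N).
  by rewrite /w /h expr0 !divr1 /W /H !(addrC _ (_ - _)) !subrK.
apply/eqP; rewrite -normc_eq0 eq_le normc_ge0 andbT.
pose S := W + H; have S0 : 0 <= S by rewrite addr_ge0.
suff small e : 0 < e -> J 0%N (s 0%N) <= e * (4 * S ^+ 2).
  apply/ler_addgt0Pr => e e0; rewrite add0r.
  have K0 : 0 < 4 * S ^+ 2 + 1 by rewrite ltr_wpDl // mulr_ge0 // sqr_ge0.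
  apply: le_trans (small (e / (4 * S ^+ 2 + 1)) _) _; first by rewrite divr_gt0.
  rewrite mulrAC ler_pdivrMr // ler_wpM2l ?ltW //; lra.
move=> e0; pose p := mkc X Y.
have dp : derivable f p 1.
  apply: df; have := HX 0%N; have := HY 0%N; have [] := sg 0%N.
  by rewrite /p => ? ? ? ? ? ?; split; rewrite !reimE; lra.
have [d d0 Hd] := (is_derive_cplxP _ _ _).1 (derivableP dp) _ e0.
set l := 'D_1 f p in Hd.
have [n Hn] := exp2_half_lt S d0.
apply: le_trans (JE n) _.
have [g1 g2 g3 g4] := sg n; have := HX n; have := HY n => hY hX.
pose A z := f p - l * p + l * z.
pose B z := f z + -1 * A z.
have cA z : {for z, continuous A}.
  apply: (@continuousD _ _ _ (cst (f p - l * p)) (fun z => l * z)).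
    exact: cst_continuous.
  apply: (@continuousM _ _ (cst l) id); first exact: cst_continuous.
  exact: cvg_id.
have cA1 z : {for z, continuous (fun z => -1 * A z)}.
  apply: (@continuousM _ _ (cst (-1)) A); first exact: cst_continuous.
  exact: cA.
pose a0 := (s n).1; pose b0 := (s n).2.
have sub : rect a0 (a0 + w n) b0 (b0 + h n) `<=` rect x0 x1 y0 y1.
  exact: sub_rect.
have wn := w0 n; have hn := h0 n.
have a01 : a0 <= a0 + w n by rewrite lerDl.
have b01 : b0 <= b0 + h n by rewrite lerDl.
have fbc : cont_bd f a0 (a0 + w n) b0 (b0 + h n).
  apply: (cont_bd_of_rect a01 b01) => z /sub hz; exact: cf.
have Abc : cont_bd A a0 (a0 + w n) b0 (b0 + h n).
  by apply: (cont_bd_of_rect a01 b01) => z _; exact: cA.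
have A1bc : cont_bd (fun z => -1 * A z) a0 (a0 + w n) b0 (b0 + h n).
  by apply: (cont_bd_of_rect a01 b01) => z _; exact: cA1.
have Bbc : cont_bd B a0 (a0 + w n) b0 (b0 + h n).
  apply: (cont_bd_of_rect a01 b01) => z /sub hz.
  by apply: (@continuousD _ _ _ f (fun z => -1 * A z)); [exact: cf|exact: cA1].
have JB : rect_int f a0 (a0 + w n) b0 (b0 + h n) =
    rect_int B a0 (a0 + w n) b0 (b0 + h n).
  by rewrite /B rect_intD // rect_intZ // rect_int_affine // mulr0 addr0.
have SE : S / 2 ^+ n = w n + h n by rewrite /S mulrDl.
rewrite /J JB.
have bnd : normc (rect_int B a0 (a0 + w n) b0 (b0 + h n)) <=
    4 * (e * (S / 2 ^+ n)) * (a0 + w n - a0 + (b0 + h n - b0)).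
  apply: rect_int_bound => // z [[hz1 hz2] _].
  have nz : normc (z - p) <= S / 2 ^+ n.
    apply: le_trans (normc_le_reim _) _; rewrite reB imB /p !reimE SE.
    by apply: lerD; rewrite ler_norml; clear -hz1 hz2 hX hY;
      rewrite -/a0 -/b0 in hX hY; lra.
  have := Hd z (le_lt_trans nz Hn).
  have -> : f z - f p - l * (z - p) = B z by rewrite /B /A; ring.
  by move=> /le_trans; apply; rewrite ler_wpM2l // ltW.
apply: (@le_trans _ _ ((2 ^+ n) ^+ 2 * (4 * (e * (S / 2 ^+ n)) * (S / 2 ^+ n)))).
  rewrite ler_wpM2l ?sqr_ge0 //; apply: le_trans bnd _.
  by rewrite [X in _ * X <= _](_ : _ = S / 2 ^+ n) // SE; ring.
have := p2 n; set t := 2 ^+ n => t0.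
by rewrite le_eqVlt; apply/orP; left; apply/eqP; field; rewrite gt_eqF.
Qed.

End Goursat.


(** * Cauchy's formula on a rectangle *)

Section MaximumModulus.
Variable R : realType.
Implicit Types (f g : cplx R -> cplx R) (x y : R) (a z : cplx R).
Local Notation mu := lebesgue_measure.

Definition rect_in x0 x1 y0 y1 : set (cplx R) :=
  [set z | x0 < re z < x1 /\ y0 < im z < y1].

Lemma rect_bd_neq x0 x1 y0 y1 a z : rect_in x0 x1 y0 y1 a ->
  rect_bd x0 x1 y0 y1 z -> z != a.
Proof.
by move=> [/andP[a1 a2] /andP[a3 a4]] [_ zb]; apply/eqP => za;
  move: zb; rewrite za => -[] E; lra.
Qed.

Lemma cont_bd_of_bd f x0 x1 y0 y1 : x0 <= x1 -> y0 <= y1 ->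
  (forall z, rect_bd x0 x1 y0 y1 z -> {for z, continuous f}) ->
  cont_bd f x0 x1 y0 y1.
Proof.
move=> x01 y01 cf; split=> t ht; apply: cf; split.
- by split; rewrite reimE ?ht ?lexx.
- by constructor 3.
- by split; rewrite reimE ?ht ?lexx ?andbT.
- by constructor 4.
- by split; rewrite reimE ?ht ?lexx.
- by constructor 1.
- by split; rewrite reimE ?ht ?lexx ?andbT.
- by constructor 2.
Qed.

(** A radius [r] for which the square of half side [r] about an interior point
    stays in the rectangle, together with two smallness requirements. *)
Lemma exists_margin (x0 xa x1 y0 ya y1 d t : R) :
  x0 < xa -> xa < x1 -> y0 < ya -> ya < y1 -> 0 < d -> 0 < t ->
  exists r, [/\ 0 < r, 3 * r <= d & r <= t] /\
    [/\ x0 <= xa - r, xa - r <= xa + r & xa + r <= x1] /\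
    [/\ y0 <= ya - r, ya - r <= ya + r & ya + r <= y1].
Proof.
move=> x0a xa1 y0a ya1 d0 t0.
pose m := Num.min (xa - x0) (Num.min (x1 - xa)
  (Num.min (ya - y0) (Num.min (y1 - ya) (Num.min (d / 3) t)))).
have m0 : 0 < m.
  by rewrite !lt_min t0 andbT !subr_gt0 x0a xa1 y0a ya1 divr_gt0.
have : m <= m by []; rewrite {2}/m !le_min => /and5P[r1 r2 r3 r4 /andP[r5 r6]].
exists m; do ?split; lra.
Qed.

(** Four applications of [goursat] cut the rectangle down to a small square about
    [a], where boundedness makes the integral as small as the perimeter. *)
Lemma goursat_punctured g a x0 x1 y0 y1 (d M : R) : rect_in x0 x1 y0 y1 a ->
  (forall z, rect x0 x1 y0 y1 z -> z != a -> derivable g z 1) ->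
  0 < d -> (forall z, z != a -> normc (z - a) < d -> normc (g z) <= M) ->
  rect_int g x0 x1 y0 y1 = 0.
Proof.
move=> [/andP[a1 a2] /andP[a3 a4]] dg d0 gM.
have cg z : rect x0 x1 y0 y1 z -> z != a -> {for z, continuous g}.
  by move=> hz za; apply: cplx_derivable_continuous; exact: dg.
apply/eqP; rewrite -normc_eq0 eq_le normc_ge0 andbT.
apply/ler_addgt0Pr => e e0; rewrite add0r.
pose t := e / (16 * (`|M| + 1)).
have M1 : 0 < `|M| + 1 by rewrite ltr_wpDl.
have t0 : 0 < t by rewrite divr_gt0 // mulr_gt0.
have [r [] +[]] := exists_margin a1 a2 a3 a4 d0 t0.
set xa := re a in a1 a2 *; set ya := im a in a3 a4 *.
move=> [r0 rd rt] [xm xr rx] [ym yr ry].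
have xc : xa - r < xa by rewrite ltrBlDr ltrDl.
have yc : ya - r < ya by rewrite ltrBlDr ltrDl.
have cx : xa < xa + r by rewrite ltrDl.
have cy : ya < ya + r by rewrite ltrDl.
have xmr := le_trans xr rx; have ymr := le_trans yr ry.
have xx := le_trans xm xmr; have yy := le_trans ym ymr.
have xmx := le_trans xm xr; have ymy := le_trans ym yr.
have piece u0 u1 v0 v1 : x0 <= u0 -> u0 <= u1 -> u1 <= x1 ->
    y0 <= v0 -> v0 <= v1 -> v1 <= y1 ->
    [\/ u1 < xa, xa < u0, v1 < ya | ya < v0] -> rect_int g u0 u1 v0 v1 = 0.
  move=> ? ? ? ? ? ? H; apply: goursat => // z zr; apply: dg.
    by apply: sub_rect zr.
  case: zr => /andP[z1 z2] /andP[z3 z4].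
  apply/eqP => za; move: z1 z2 z3 z4 H; rewrite za -/xa -/ya; clear.
  by move=> ? ? ? ? []; lra.
have bc u0 u1 v0 v1 : x0 <= u0 -> u0 <= u1 -> u1 <= x1 ->
    y0 <= v0 -> v0 <= v1 -> v1 <= y1 ->
    u0 < xa -> xa < u1 -> v0 < ya -> ya < v1 -> cont_bd g u0 u1 v0 v1.
  move=> ? u ? ? v ? ? ? ? ?; apply: (cont_bd_of_bd u v) => z zb; apply: cg.
    by case: zb => zr _; apply: sub_rect zr.
  by apply: rect_bd_neq zb; split; apply/andP; split.
have p1 : rect_int g x0 (xa - r) y0 y1 = 0.
  by apply: piece => //; constructor 1.
have p2 : rect_int g (xa + r) x1 y0 y1 = 0.
  by apply: piece => //; constructor 2.
have p3 : rect_int g (xa - r) (xa + r) y0 (ya - r) = 0.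
  by apply: piece => //; constructor 3.
have p4 : rect_int g (xa - r) (xa + r) (ya + r) y1 = 0.
  by apply: piece => //; constructor 4.
have b1 : cont_bd g x0 x1 y0 y1 by apply: bc.
have b2 : cont_bd g (xa - r) x1 y0 y1 by apply: bc.
have b3 : cont_bd g (xa - r) (xa + r) y0 y1 by apply: bc.
have b4 : cont_bd g (xa - r) (xa + r) (ya - r) y1 by apply: bc.
have b5 : cont_bd g (xa - r) (xa + r) (ya - r) (ya + r) by apply: bc.
rewrite (rect_int_splitx xm xmr b1) p1 add0r.
rewrite (rect_int_splitx xr rx b2) p2 addr0.
rewrite (rect_int_splity ym ymr b3) p3 add0r (rect_int_splity yr ry b4).
rewrite p4 addr0.
have H : normc (rect_int g (xa - r) (xa + r) (ya - r) (ya + r)) <=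
    4 * (`|M| + 1) * (xa + r - (xa - r) + (ya + r - (ya - r))).
  apply: rect_int_bound => // z zb.
  apply: (@le_trans _ _ M); last by rewrite (le_trans (ler_norm M)) // lerDl.
  apply: gM.
    by apply: rect_bd_neq zb; split; apply/andP; split.
  apply: le_lt_trans (normc_le_reim _) _; rewrite reB imB -/xa -/ya.
  case: zb => -[]; clear -r0 rd => /andP[z1 z2] /andP[z3 z4] _.
  have : `|re z - xa| <= r by rewrite ler_norml; lra.
  have : `|im z - ya| <= r by rewrite ler_norml; lra.
  lra.
apply: le_trans H _.
have -> : 4 * (`|M| + 1) * (xa + r - (xa - r) + (ya + r - (ya - r))) =
  r * (16 * (`|M| + 1)) by ring.
by rewrite -ler_pdivlMr ?mulr_gt0.
Qed.

Lemma derivable_subr a z : derivable (fun w : cplx R => w - a) z 1.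
Proof.
apply: (@derivableB _ _ _ id (cst a)); first exact: derivable_id.
exact: derivable_cst.
Qed.

Lemma derivable_invB a z : z != a ->
  derivable (fun w : cplx R => (w - a)^-1) z 1.
Proof.
move=> za; apply: derivableV; first by rewrite subr_eq0.
exact: derivable_subr.
Qed.

(** The imaginary part of [dz / (z - a)] is the variation of the argument of
    [z - a], which is positive along each side. *)
Lemma cauchy_kernel_neq0 a x0 x1 y0 y1 : rect_in x0 x1 y0 y1 a ->
  rect_int (fun z => (z - a)^-1) x0 x1 y0 y1 != 0.
Proof.
move=> ain; have [/andP[a1 a2] /andP[a3 a4]] := ain.
pose k z := (z - a)^-1.
have [/cont_hline_seg h0 /cont_hline_seg h1 /cont_vline_seg v0 /cont_vline_seg v1] :
    cont_bd k x0 x1 y0 y1.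
  apply: cont_bd_of_bd => [||z zb]; [lra|lra|].
  apply: cplx_derivable_continuous; apply: derivable_invB.
  exact: rect_bd_neq zb.
suff : 0 < im (rect_int k x0 x1 y0 y1).
  by apply: contraTneq => ->; rewrite reimE ltxx.
rewrite /rect_int !reimE mul0r mul1r add0r.
have I0 : 0 < \int[mu]_(x in `[x0, x1]) im (k (mkc x y0)).
  pose m := (im a - y0) / ((x1 - x0) ^+ 2 + (y1 - y0) ^+ 2).
  have D0 : 0 < (x1 - x0) ^+ 2 + (y1 - y0) ^+ 2.
    by rewrite ltr_pwDl ?sqr_ge0 // exprn_gt0 //; lra.
  have m0 : 0 < m by rewrite divr_gt0 //; lra.
  apply: (@lt_le_trans _ _ (m * (x1 - x0))); first by rewrite mulr_gt0 //; lra.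
  apply: Rintegral_seg_ge => [|x /h0[]|x /andP[hx hx']] //; first lra.
  rewrite /k imV reB imB !reimE opprB ler_pM2l; last lra.
  rewrite lef_pV2 ?posrE //; last first.
    by rewrite ltr_wpDl ?sqr_ge0 // exprn_even_gt0 //= lt_eqF //; lra.
  apply: lerD.
    by rewrite -[(x - _) ^+ 2]real_normK ?num_real // lerXn2r ?nnegrE //; [lra|rewrite ler_norml; lra].
  by rewrite -(sqrrN (y0 - _)) lerXn2r ?nnegrE //; lra.
have I1 : \int[mu]_(x in `[x0, x1]) im (k (mkc x y1)) <= 0.
  rewrite -(mul0r (x1 - x0)).
  apply: Rintegral_seg_le => [|x /h1[]|x hx] //; first lra.
  rewrite /k imV imB !reimE mulNr oppr_le0 divr_ge0 //; first lra.
  by rewrite addr_ge0 // sqr_ge0.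
have I2 : \int[mu]_(y in `[y0, y1]) re (k (mkc x0 y)) <= 0.
  rewrite -(mul0r (y1 - y0)).
  apply: Rintegral_seg_le => [|y /v0[]|y hy] //; first lra.
  rewrite /k reV reB !reimE -oppr_ge0 -mulNr divr_ge0 //; first lra.
  by rewrite addr_ge0 // sqr_ge0.
have I3 : 0 <= \int[mu]_(y in `[y0, y1]) re (k (mkc x1 y)).
  rewrite -(mul0r (y1 - y0)).
  apply: Rintegral_seg_ge => [|y /v1[]|y hy] //; first lra.
  rewrite /k reV reB !reimE divr_ge0 //; first lra.
  by rewrite addr_ge0 // sqr_ge0.
rewrite /k in I0 I1 I2 I3 *; lra.
Qed.

(** The divided difference [(f z - f a) / (z - a)] is bounded near [a], so that
    [goursat_punctured] applies to it. *)
Theorem cauchy_formula f a x0 x1 y0 y1 : rect_in x0 x1 y0 y1 a ->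
  (forall z, rect x0 x1 y0 y1 z -> derivable f z 1) ->
  rect_int (fun z => f z * (z - a)^-1) x0 x1 y0 y1 =
  f a * rect_int (fun z => (z - a)^-1) x0 x1 y0 y1.
Proof.
move=> ain df; have [/andP[a1 a2] /andP[a3 a4]] := ain.
have ar : rect x0 x1 y0 y1 a by split; apply/andP; split; lra.
pose k z := (z - a)^-1; pose g z := (f z + - f a) * k z.
have dk z : z != a -> derivable k z 1 by exact: derivable_invB.
have dg z : rect x0 x1 y0 y1 z -> z != a -> derivable g z 1.
  move=> zr za; apply: (@derivableM _ _ (fun z => f z + - f a) k); last exact: dk.
  by apply: (@derivableD _ _ _ f (cst (- f a))); [exact: df|exact: derivable_cst].
have [d d0 Hd] : exists2 d : R, 0 < d & forall z, z != a -> normc (z - a) < d ->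
    normc (g z) <= normc ('D_1 f a) + 1.
  have [d d0 Hd] := (is_derive_cplxP _ _ _).1 (derivableP (df _ ar)) _ ltr01.
  exists d => // z za /Hd H; rewrite /g /k normcM normcV.
  have n0 : 0 < normc (z - a) by rewrite normc_gt0 subr_eq0.
  rewrite ler_pdivrMr //.
  have := normc_tri (f z - f a) ('D_1 f a * (z - a)).
  rewrite normcM; lra.
have g0 := goursat_punctured ain dg d0 Hd.
have ck z : rect_bd x0 x1 y0 y1 z -> {for z, continuous k}.
  by move=> zb; apply: cplx_derivable_continuous; apply: dk; exact: rect_bd_neq zb.
have cg z : rect_bd x0 x1 y0 y1 z -> {for z, continuous g}.
  move=> zb; apply: cplx_derivable_continuous; apply: dg.
    by case: zb.
  exact: rect_bd_neq zb.
have bk : cont_bd k x0 x1 y0 y1 by apply: cont_bd_of_bd => //; lra.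
have bg : cont_bd g x0 x1 y0 y1 by apply: cont_bd_of_bd => //; lra.
have bfk : cont_bd (fun z => f a * k z) x0 x1 y0 y1.
  apply: cont_bd_of_bd => [||z /ck cz]; [lra|lra|].
  by apply: (@continuousM _ _ (cst (f a)) k); [exact: cst_continuous|exact: cz].
have -> : (fun z => f z * k z) = (fun z => g z + f a * k z).
  by apply/funext => z; rewrite /g; ring.
by rewrite rect_intD // g0 add0r rect_intZ.
Qed.

End MaximumModulus.


(** * The maximum modulus principle *)

Section Regularity.
Variable R : realType.
Implicit Types (f g : cplx R -> cplx R) (x y : R) (a z p q : cplx R).

(** The device that removes multiplicative constants from a bound which is known
    for all powers. *)
Lemma le_of_pow_le (u M C : R) : 0 <= u -> 0 <= M ->
  (forall n, u ^+ n <= C * M ^+ n) -> u <= M.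
Proof.
move=> u0 M0 H; rewrite leNgt; apply/negP => Mu.
have u0' : 0 < u by apply: le_lt_trans Mu.
pose t := M / u.
have t1 : `|t| < 1 by rewrite ger0_norm ?divr_ge0 // ltr_pdivrMr // mul1r.
have H1 n : 1 <= C * t ^+ n.
  by rewrite /t expr_div_n mulrA ler_pdivlMr ?exprn_gt0 // mul1r.
have C0 : 0 < C by apply: lt_le_trans (ltr01) _; have := H1 0%N; rewrite mulr1.
have /cvgr0Pnorm_lt /(_ C^-1) := cvg_expr t1.
rewrite invr_gt0 => /(_ C0) [n _ /(_ n (leqnn n))] /=.
rewrite ger0_norm ?exprn_ge0 ?divr_ge0 //.
by rewrite -[C^-1]mul1r ltr_pdivlMr // mulrC ltNge H1.
Qed.

Lemma derivable_expfun f z n : derivable f z 1 ->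
  derivable (fun w => f w ^+ n) z 1.
Proof.
move=> df; elim: n => [|n IH]; first exact: derivable_cst.
have -> : (fun w => f w ^+ n.+1) = f * (fun w => f w ^+ n).
  by apply/funext => w; rewrite exprS.
by apply: derivableM; [exact: df|exact: IH].
Qed.

Lemma continuous_expfun f z n : {for z, continuous f} ->
  {for z, continuous (fun w => f w ^+ n)}.
Proof.
move=> cf; elim: n => [|n IH]; first exact: cst_continuous.
have -> : (fun w => f w ^+ n.+1) = (fun w => f w * f w ^+ n).
  by apply/funext => w; rewrite exprS.
by apply: (@continuousM _ _ f (fun w => f w ^+ n)); [exact: cf|exact: IH].
Qed.

Lemma rect_bd_far x0 x1 y0 y1 (a : cplx R) : rect_in x0 x1 y0 y1 a ->
  exists2 r : R, 0 < r & forall z, rect_bd x0 x1 y0 y1 z -> r <= normc (z - a).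
Proof.
move=> [/andP[a1 a2] /andP[a3 a4]].
have [r [[r0 _ _] [[r1 _ r2] [r3 _ r4]]]] :=
  exists_margin a1 a2 a3 a4 ltr01 ltr01.
exists r => // z [_ zb].
have [H|H] : r <= `|re z - re a| \/ r <= `|im z - im a|.
- case: zb => E; [left|left|right|right]; rewrite E ler_normr; apply/orP;
    clear -r1 r2 r3 r4; first [left; lra | right; lra].
- by apply: le_trans H _; rewrite -reB re_le_normc.
- by apply: le_trans H _; rewrite -imB im_le_normc.
Qed.

(** Cauchy's formula for [f ^ n] bounds [|f a| ^ n] by a constant, independent of
    [n], times [M ^ n]. *)
Lemma max_modulus_rect f a M x0 x1 y0 y1 : rect_in x0 x1 y0 y1 a ->
  (forall z, rect x0 x1 y0 y1 z -> derivable f z 1) ->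
  (forall z, rect_bd x0 x1 y0 y1 z -> normc (f z) <= M) ->
  normc (f a) <= M.
Proof.
move=> ain df fM; have [/andP[a1 a2] /andP[a3 a4]] := ain.
have x01 : x0 <= x1 by rewrite ltW // (lt_trans a1).
have y01 : y0 <= y1 by rewrite ltW // (lt_trans a3).
have M0 : 0 <= M.
  apply: le_trans (normc_ge0 _) (fM (mkc x0 y0) _).
  by split; [split; rewrite reimE lexx|constructor 1].
have [r r0 rP] := rect_bd_far ain.
have := cauchy_kernel_neq0 ain; set K := rect_int _ _ _ _ _ => K0.
have k0 : 0 < normc K by rewrite normc_gt0.
apply: (@le_of_pow_le _ _ (4 / r * (x1 - x0 + (y1 - y0)) / normc K)) => //.
  exact: normc_ge0.
move=> n; rewrite mulrAC ler_pdivlMr //.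
have dfn z : rect x0 x1 y0 y1 z -> derivable (fun z => f z ^+ n) z 1.
  by move=> /df; exact: derivable_expfun.
rewrite -normcX -normcM -/K -(cauchy_formula ain dfn).
rewrite [leRHS](_ : _ = 4 * (M ^+ n / r) * (x1 - x0 + (y1 - y0))); last first.
  by ring.
apply: rect_int_bound => //.
  apply: (cont_bd_of_bd x01 y01) => z zb; apply: cplx_derivable_continuous.
  apply: (@derivableM _ _ (fun z => f z ^+ n) (fun z => (z - a)^-1)).
    by apply: dfn; case: zb.
  by apply: derivable_invB; exact: rect_bd_neq zb.
move=> z zb; rewrite normcM normcX normcV.
apply: ler_pM; rewrite ?exprn_ge0 ?invr_ge0 ?normc_ge0 //.
  by apply: lerXn2r; rewrite ?nnegrE ?normc_ge0 //; exact: fM.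
by rewrite lef_pV2 ?posrE ?rP // (lt_le_trans r0 (rP _ zb)).
Qed.

(** Multiplication by [z - p] restores differentiability at a point [p] of mere
    continuity. *)
Lemma derivable_continuous_mulB f p : {for p, continuous f} ->
  derivable (fun z => f z * (z - p)) p 1.
Proof.
move=> cf.
have H z : f z * (z - p) - f p * (p - p) = f z * (z - p) by ring.
exact: (@ex_derive _ _ _ _ _ _ _ (is_derive_caratheodory H cf)).
Qed.

Lemma normc_rect_bound x0 x1 y0 y1 p : exists2 B : R, 0 < B &
  forall z, rect x0 x1 y0 y1 z -> normc (z - p) <= B.
Proof.
exists (1 + (`|x0| + `|x1| + (`|y0| + `|y1|)) + normc p).
  by rewrite ltr_pwDl ?normc_ge0 // ltr_pwDl // !addr_ge0.
move=> z [zx zy]; apply: le_trans (normcB _ _) _; rewrite lerD2r.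
apply: le_trans (normc_le_reim _) _; apply: ler_wpDl => //.
have H (u v t : R) : u <= t <= v -> `|t| <= `|u| + `|v|.
  move=> /andP[ut tv]; rewrite ler_norml.
  have := ler_norm v; have := ler_norm (- u); rewrite normrN.
  by have := normr_ge0 u; have := normr_ge0 v; lra.
by apply: lerD; exact: H.
Qed.

(** Apply the maximum principle to [f z ^ n * (z - p) * (z - q)], which is
    differentiable at [p] and [q] too. The two linear factors only contribute a
    constant, removed by [le_of_pow_le]; the points [p] and [q] themselves are
    reached by continuity. *)
Lemma max_modulus_rect2 f a p q M x0 x1 y0 y1 : rect_in x0 x1 y0 y1 a ->
  (forall z, rect x0 x1 y0 y1 z -> {for z, continuous f}) ->
  (forall z, rect x0 x1 y0 y1 z -> z != p -> z != q -> derivable f z 1) ->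
  (forall z, rect_bd x0 x1 y0 y1 z -> normc (f z) <= M) ->
  normc (f a) <= M.
Proof.
move=> ain cf df fM.
have off b : rect_in x0 x1 y0 y1 b -> b != p -> b != q -> normc (f b) <= M.
  move=> {a ain}bin bp bq; have [/andP[a1 a2] /andP[a3 a4]] := bin.
  have M0 : 0 <= M.
    apply: le_trans (normc_ge0 _) (fM (mkc x0 y0) _).
    split; [split; rewrite reimE lexx|constructor 1] => //.
      by rewrite ltW // (lt_trans a1).
    by rewrite ltW // (lt_trans a3).
  have [B B0 HB] := normc_rect_bound x0 x1 y0 y1 p.
  have [C C0 HC] := normc_rect_bound x0 x1 y0 y1 q.
  have bp0 : 0 < normc (b - p) by rewrite normc_gt0 subr_eq0.
  have bq0 : 0 < normc (b - q) by rewrite normc_gt0 subr_eq0.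
  have bpq0 : 0 < normc (b - p) * normc (b - q) by rewrite mulr_gt0.
  apply: (@le_of_pow_le _ _ (B * C / (normc (b - p) * normc (b - q)))) => //.
    exact: normc_ge0.
  move=> n; rewrite mulrAC ler_pdivlMr // -normcX -!normcM mulrA.
  pose F z := f z ^+ n * (z - p) * (z - q).
  have cfn z : rect x0 x1 y0 y1 z -> {for z, continuous (fun z => f z ^+ n)}.
    by move=> /cf; exact: continuous_expfun.
  have cB c z : {for z, continuous (fun w : cplx R => w - c)}.
    by apply: cplx_derivable_continuous; exact: derivable_subr.
  have dF z : rect x0 x1 y0 y1 z -> derivable F z 1.
    move=> zr; have [zq|zq] := eqVneq z q.
      rewrite zq in zr *; apply: (@derivable_continuous_mulB (fun z => f z ^+ n * (z - p))).
      apply: (@continuousM _ _ (fun z => f z ^+ n) (fun z => z - p)).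
        exact: cfn.
      exact: cB.
    have [zp|zp] := eqVneq z p.
      rewrite zp in zr *.
      have -> : F = fun z => f z ^+ n * (z - q) * (z - p).
        by apply/funext => w; rewrite /F mulrAC.
      apply: (@derivable_continuous_mulB (fun z => f z ^+ n * (z - q))).
      apply: (@continuousM _ _ (fun z => f z ^+ n) (fun z => z - q)).
        exact: cfn.
      exact: cB.
    apply: (@derivableM _ _ (fun z => f z ^+ n * (z - p)) (fun z => z - q)).
      apply: (@derivableM _ _ (fun z => f z ^+ n) (fun z => z - p)).
        by apply: derivable_expfun; exact: df.
      exact: derivable_subr.
    exact: derivable_subr.
  rewrite [leRHS](_ : _ = M ^+ n * B * C); last by ring.
  apply: (@max_modulus_rect F b _ _ _ _ _ bin dF) => z zb.
  rewrite /F !normcM normcX; have [zr _] := zb.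
  apply: ler_pM; rewrite ?mulr_ge0 ?exprn_ge0 ?normc_ge0 ?HC //.
  apply: ler_pM; rewrite ?exprn_ge0 ?normc_ge0 ?HB //.
  by apply: lerXn2r; rewrite ?nnegrE ?normc_ge0 // fM.
have ar : rect x0 x1 y0 y1 a.
  by case: ain => /andP[a1 a2] /andP[a3 a4]; split; rewrite !ltW.
apply/ler_addgt0Pr => e e0.
have [d d0 Hd] := (continuous_cplxP _ _).1 (cf _ ar) _ e0.
have [/andP[a1 a2] /andP[a3 a4]] := ain.
have [r [[r0 _ rd] [[r1 _ r2] _]]] := exists_margin a1 a2 a3 a4 ltr01 d0.
have near_a t : 0 < t -> t < r -> a + mkc t 0 != p -> a + mkc t 0 != q ->
    normc (f a) <= M + e.
  move=> t0 tr tp tq; pose b := a + mkc t 0.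
  have bin : rect_in x0 x1 y0 y1 b.
    split; rewrite /b !reimE ?addr0 ?a3 ?a4 //.
    by clear -t0 tr r1 r2 a1; lra.
  have ba : normc (b - a) < d.
    rewrite /b addrC addKr normc_re ger0_norm ?ltW //.
    by apply: lt_le_trans rd.
  have fb := off b bin tp tq.
  have := Hd _ ba; have := normc_tri (f a) (f b); rewrite normcC.
  by clear -fb; lra.
(* of the three points a + r/2, a + r/3, a + r/4 one differs from p and q *)
have neq (s t : R) c : s != t -> a + mkc s 0 = c -> a + mkc t 0 != c.
  move=> st <-; apply: contra_neq st => /addrI /(congr1 (@re R)).
  by rewrite !reimE.
have n12 : r / 2 != r / 3 by apply/eqP; clear -r0; lra.
have n13 : r / 2 != r / 4 by apply/eqP; clear -r0; lra.
have n23 : r / 3 != r / 4 by apply/eqP; clear -r0; lra.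
have h2 : 0 < r / 2 /\ r / 2 < r by clear -r0; lra.
have h3 : 0 < r / 3 /\ r / 3 < r by clear -r0; lra.
have h4 : 0 < r / 4 /\ r / 4 < r by clear -r0; lra.
have [E2p|E2p] := eqVneq (a + mkc (r / 2) 0) p.
  have [E3q|E3q] := eqVneq (a + mkc (r / 3) 0) q.
    apply: (near_a (r / 4)); [by case: h4|by case: h4|exact: neq E2p|].
    exact: neq E3q.
  by apply: (near_a (r / 3)); [by case: h3|by case: h3|exact: neq E2p|].
have [E2q|E2q] := eqVneq (a + mkc (r / 2) 0) q.
  have [E3p|E3p] := eqVneq (a + mkc (r / 3) 0) p.
    apply: (near_a (r / 4)); [by case: h4|by case: h4|exact: neq E3p|].
    exact: neq E2q.
  apply: (near_a (r / 3)); [by case: h3|by case: h3|exact: E3p|].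
  exact: neq E2q.
by apply: (near_a (r / 2)); [by case: h2|by case: h2|exact: E2p|].
Qed.

End Regularity.


(** * Divided differences and regularity of the derivative *)

Section Slope.
Variable R : realType.
Implicit Types (f g : cplx R -> cplx R) (x y s : R) (a b z w p q c : cplx R).

Lemma compact_rect x0 x1 y0 y1 : compact (rect x0 x1 y0 y1 : set (cplx R)).
Proof.
pose A : set (R * R) := `[x0, x1]%classic `*` `[y0, y1]%classic.
have cA : compact A by apply: compact_setX; exact: segment_compact.
pose h (u : R * R) : cplx R := mkc u.1 u.2.
have ch : continuous h.
  move=> u P /nbhs_cplxP[e e0 He].
  have e2 : 0 < e / 2 by rewrite divr_gt0.
  apply/nbhs_ballP; exists (e / 2) => //= v [/= uv1 uv2]; apply: He.
  apply: le_lt_trans (normc_le_reim _) _; rewrite /h !reimE.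
  rewrite /ball /= distrC in uv1; rewrite /ball /= distrC in uv2.
  by move: (ltrD uv1 uv2); rewrite -splitr.
have -> : rect x0 x1 y0 y1 = h @` A.
  apply/seteqP; split => [z [zx zy]|_ [u [ux uy] <-]].
    by exists (re z, im z); [split; rewrite /= in_itv|exact/esym/mkcE].
  by move: ux uy; rewrite /= !in_itv.
apply: continuous_compact cA; apply: continuous_subspaceT; exact: ch.
Qed.

Lemma rect_bounded f x0 x1 y0 y1 :
  (forall z, rect x0 x1 y0 y1 z -> {for z, continuous f}) ->
  exists2 M : R, 0 < M & forall z, rect x0 x1 y0 y1 z -> normc (f z) <= M.
Proof.
move=> cf; have [[z0 hz0]|ne] := EM (rect x0 x1 y0 y1 !=set0); last first.
  by exists 1 => // z hz; case: ne; exists z.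
have [|c _ Hc] := @compact_EVT_max _ R (fun z => normc (f z)) _
  (ex_intro _ z0 hz0) (@compact_rect x0 x1 y0 y1).
  apply: continuous_in_subspaceT => z; rewrite inE => /cf cz.
  apply: (@continuous_comp _ _ _ f (fun w : cplx R => normc w)); first exact: cz.
  exact: continuous_normc.
exists (normc (f c) + 1); first by rewrite ltr_wpDl // normc_ge0.
move=> z hz; apply: le_trans (Hc z _) _; first by rewrite inE.
by rewrite lerDl.
Qed.

Lemma is_derive_near_eq f g a (l : cplx R) (d : R) : 0 < d ->
  (forall w, normc (w - a) < d -> f w = g w) ->
  is_derive a (1 : cplx R) f l -> is_derive a (1 : cplx R) g l.
Proof.
move=> d0 fg /is_derive_cplxP H; apply/is_derive_cplxP => e e0.
have [r r0 Hr] := H _ e0; exists (Num.min r d); first by rewrite lt_min r0.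
move=> w; rewrite lt_min => /andP[wr wd].
by rewrite -!fg //; [exact: Hr|rewrite subrr normc0].
Qed.

Lemma derivable_near_eq f g z (d : R) : 0 < d ->
  (forall w, normc (w - z) < d -> f w = g w) ->
  derivable f z 1 -> derivable g z 1.
Proof.
move=> d0 fg /derivableP df.
exact: (@ex_derive _ _ _ _ _ _ _ (is_derive_near_eq d0 fg df)).
Qed.

Definition slope f a z := if z == a then 'D_1 f a else (f z - f a) / (z - a).

Lemma slopeC f a b : slope f a b = slope f b a.
Proof.
rewrite /slope eq_sym; case: eqVneq => [->//|ba].
by rewrite -(opprB (f a)) -(opprB a) invrN mulrNN.
Qed.

Lemma slope_id f a : slope f a a = 'D_1 f a.
Proof. by rewrite /slope eqxx. Qed.

Lemma slopeE f a z : f z - f a = slope f a z * (z - a).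
Proof.
rewrite /slope; case: eqVneq => [->|za]; first by rewrite !subrr mulr0.
by rewrite divfK // subr_eq0.
Qed.

Lemma derivable_slope f a z : z != a -> derivable f z 1 ->
  derivable (slope f a) z 1.
Proof.
move=> za df; have d0 : 0 < normc (z - a) by rewrite normc_gt0 subr_eq0.
apply: (derivable_near_eq (f := fun z => (f z + - f a) * (z - a)^-1) d0).
  move=> w wz; rewrite /slope; case: eqVneq => // wa.
  by move: wz; rewrite wa normcC ltxx.
apply: (@derivableM _ _ (fun z => f z + - f a) (fun z => (z - a)^-1)).
  by apply: (@derivableD _ _ _ f (cst (- f a))); [exact: df|exact: derivable_cst].
exact: derivable_invB.
Qed.

Lemma continuous_slope_off f a z : z != a -> {for z, continuous f} ->
  {for z, continuous (slope f a)}.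
Proof.
move=> za cf; have d0 : 0 < normc (z - a) by rewrite normc_gt0 subr_eq0.
pose q w := (f w + - f a) * (w - a)^-1.
have cq : {for z, continuous q}.
  apply: (@continuousM _ _ (fun w => f w + - f a) (fun w => (w - a)^-1)).
    apply: (@continuousD _ _ _ f (cst (- f a))); first exact: cf.
    exact: cst_continuous.
  by apply: cplx_derivable_continuous; exact: derivable_invB.
have qE w : normc (w - z) < normc (z - a) -> slope f a w = q w.
  move=> wz; rewrite /slope; case: eqVneq => // wa.
  by move: wz; rewrite wa normcC ltxx.
apply/continuous_cplxP => e e0.
have [r r0 Hr] := (continuous_cplxP _ _).1 cq _ e0.
exists (Num.min r (normc (z - a))); first by rewrite lt_min r0.
move=> w; rewrite lt_min => /andP[wr wd].
by rewrite !qE //; [exact: Hr|rewrite subrr normc0].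
Qed.

Lemma continuous_slope f a z : derivable f a 1 -> derivable f z 1 ->
  {for z, continuous (slope f a)}.
Proof.
move=> da dz; have [->|za] := eqVneq z a.
  exact: (is_derive_slope (derivableP da)).
by apply: cplx_derivable_continuous; exact: derivable_slope.
Qed.

(** Half side [s]: a closed ball of the maximum norm. *)
Definition square c s : set (cplx R) :=
  rect (re c - s) (re c + s) (im c - s) (im c + s).

(** The square of half side [2 s] has boundary at distance at least [s] from the
    square of half side [s], which bounds divided differences on that boundary. *)
Lemma square_bd_slope c s (M : R) f a z : 0 < s -> square c s a ->
  rect_bd (re c - 2 * s) (re c + 2 * s) (im c - 2 * s) (im c + 2 * s) z ->
  normc (f z - f a) <= M ->
  normc (slope f a z) <= M / s.
Proof.
move=> s0 [/andP[a1 a2] /andP[a3 a4]] [_ zb] fM.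
have zas : s <= normc (z - a).
  have [H|H] : s <= `|re z - re a| \/ s <= `|im z - im a|.
  - case: zb => E; [left|left|right|right]; rewrite E ler_normr; apply/orP;
      clear -a1 a2 a3 a4; first [left; lra | right; lra].
  - by apply: le_trans H _; rewrite -reB re_le_normc.
  - by apply: le_trans H _; rewrite -imB im_le_normc.
have za : z != a.
  by rewrite -subr_eq0 -normc_gt0; apply: lt_le_trans zas.
rewrite /slope (negPf za) normcf.
apply: ler_pM; rewrite ?invr_ge0 ?normc_ge0 //.
by rewrite lef_pV2 ?posrE ?(lt_le_trans s0).
Qed.

(** [slope f a] and its own divided difference at [b] are continuous, and
    differentiable off [a] and [b]. By [max_modulus_rect2] they are bounded inside
    by their bounds on the boundary of the larger square; the second bound is the
    Lipschitz constant. *)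
Theorem slope_lipschitz f c s M : 0 < s ->
  (forall z, square c (2 * s) z -> derivable f z 1) ->
  (forall z, square c (2 * s) z -> normc (f z) <= M) ->
  forall a b w, square c s a -> square c s b -> square c s w ->
  normc (slope f a w - slope f a b) <= 4 * M / s / s * normc (w - b).
Proof.
move=> s0 df fM.
have s_in z : square c s z -> rect_in (re c - 2 * s) (re c + 2 * s)
    (im c - 2 * s) (im c + 2 * s) z.
  move=> [/andP[z1 z2] /andP[z3 z4]]; clear -s0 z1 z2 z3 z4.
  by split; apply/andP; split; lra.
have s_sub z : square c s z -> square c (2 * s) z.
  by apply: sub_rect; clear -s0; lra.
have slope_bd a z : square c s a -> rect_bd (re c - 2 * s) (re c + 2 * s)
    (im c - 2 * s) (im c + 2 * s) z -> normc (slope f a z) <= 2 * M / s.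
  move=> sa zb; apply: (square_bd_slope s0 sa zb).
  apply: le_trans (normcB _ _) _.
  have [zr _] := zb; have := fM _ zr; have := fM _ (s_sub _ sa).
  by clear; lra.
have slope_in a w : square c s a -> square c s w -> normc (slope f a w) <= 2 * M / s.
  move=> sa sw; apply: (@max_modulus_rect2 _ _ w a a _ _ _ _ _ (s_in _ sw)).
  - by move=> z zr; apply: continuous_slope; apply: df; [exact: s_sub|exact: zr].
  - by move=> z zr za _; apply: derivable_slope; [exact: za|exact: df].
  - by move=> z zb; exact: slope_bd.
have main a b w : square c s a -> square c s b -> square c s w -> b != a ->
    normc (slope (slope f a) b w) <= 4 * M / s / s.
  move=> sa sb sw ba.
  have dsb : derivable (slope f a) b 1.
    by apply: derivable_slope; [exact: ba|apply: df; exact: s_sub].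
  apply: (@max_modulus_rect2 _ _ w a b _ _ _ _ _ (s_in _ sw)).
  - move=> z zr; have [->|za] := eqVneq z a; last first.
      apply: continuous_slope; first exact: dsb.
      by apply: derivable_slope; [exact: za|exact: df].
    apply: continuous_slope_off; first by rewrite eq_sym.
    by apply: continuous_slope; apply: df; exact: s_sub.
  - move=> z zr za zb; apply: derivable_slope; first exact: zb.
    by apply: derivable_slope; [exact: za|exact: df].
  - move=> z zb; apply: (square_bd_slope s0 sb zb).
    apply: le_trans (normcB _ _) _.
    have := slope_bd _ _ sa zb; have := slope_in _ _ sa sb.
    rewrite (_ : 4 * M / s = 2 * M / s + 2 * M / s); last by ring.
    by clear; lra.
have bound a b w : square c s a -> square c s b -> square c s w -> b != a ->
    normc (slope f a w - slope f a b) <= 4 * M / s / s * normc (w - b).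
  move=> sa sb sw ba; rewrite slopeE normcM ler_wpM2r ?normc_ge0 //.
  exact: main.
move=> a b w sa sb sw; have [ba|] := eqVneq b a; last exact: bound.
have [wa|wa] := eqVneq w a.
  by rewrite wa ba !subrr normc0 mulr0.
by rewrite ba (normcC (slope f a w)) (normcC w); exact: bound.
Qed.

End Slope.


Section DerivativeRegularity.
Variable R : realType.
Implicit Types (f g : cplx R -> cplx R) (s e : R) (a b z w c : cplx R).

Lemma square_dist c s z : square c s z -> normc (z - c) <= 2 * s.
Proof.
move=> [/andP[z1 z2] /andP[z3 z4]]; apply: le_trans (normc_le_reim _) _.
rewrite reB imB mulr_natl mulr2n.
by apply: lerD; rewrite ler_norml; clear -z1 z2 z3 z4; apply/andP; split; lra.
Qed.

Lemma square_near c s z : normc (z - c) <= s -> square c s z.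
Proof.
move=> H; have := le_trans (re_le_normc _) H; have := le_trans (im_le_normc _) H.
rewrite reB imB !ler_norml => /andP[? ?] /andP[? ?]; clear H.
by split; apply/andP; split; lra.
Qed.

Lemma slope_lipschitz_ex f c s : 0 < s ->
  (forall z, square c (2 * s) z -> derivable f z 1) ->
  exists2 K : R, 0 < K & forall a b w, square c s a -> square c s b -> square c s w ->
  normc (slope f a w - slope f a b) <= K * normc (w - b).
Proof.
move=> s0 df.
have cf z : square c (2 * s) z -> {for z, continuous f}.
  by move=> /df; exact: cplx_derivable_continuous.
have [M M0 HM] := rect_bounded cf.
exists (4 * M / s / s); first by rewrite !divr_gt0 // mulr_gt0.
by apply: slope_lipschitz.
Qed.

(** The derivative is the diagonal of [slope], symmetric and Lipschitz in its
    second argument. *)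
Theorem continuous_derive f c s : 0 < s ->
  (forall z, square c (2 * s) z -> derivable f z 1) ->
  {for c, continuous (fun z => 'D_1 f z)}.
Proof.
move=> s0 df; have [K K0 HK] := slope_lipschitz_ex s0 df.
apply/continuous_cplxP => e e0.
exists (Num.min s (e / (2 * K + 1))).
  by rewrite lt_min s0 divr_gt0 // ltr_wpDl // mulr_ge0 // ltW.
move=> w; rewrite lt_min => /andP[ws we].
have sc : square c s c by apply: square_near; rewrite subrr normc0 ltW.
have sw : square c s w by apply: square_near; rewrite ltW.
have H1 := HK w c w sw sc sw; have H2 := HK c c w sc sc sw.
rewrite -!slope_id.
have := normc_triangle (slope f w c) (slope f w w) (slope f c c).
rewrite (slopeC f c w) in H2.
have K1 : 0 < 2 * K + 1 by rewrite ltr_wpDl // mulr_ge0 // ltW.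
move: we; rewrite ltr_pdivlMr // => we H3.
have n0 := normc_ge0 (w - c); clear -H1 H2 H3 we n0; nra.
Qed.

(** The difference quotients [(f (z + h) - f z) / h] are differentiable and obey
    the maximum principle after multiplication by [g]; by [slope_lipschitz] they
    converge uniformly to [f'] as [h] tends to 0. *)
Theorem max_modulus_derive f g c s (B : R) : 0 < s ->
  (forall z, square c (2 * s) z -> derivable f z 1) ->
  (forall z, square c s z -> derivable g z 1) ->
  (forall z, square c s z -> s / 2 <= normc (z - c) ->
    normc ('D_1 f z * g z) <= B) ->
  normc ('D_1 f c * g c) <= B.
Proof.
move=> s0 df dg HB; have [K K0 HK] := slope_lipschitz_ex s0 df.
have cg z : square c s z -> {for z, continuous g}.
  by move=> /dg; exact: cplx_derivable_continuous.
have [N N0 HN] := rect_bounded cg.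
have s_sub z : square c (s / 2) z -> square c s z.
  by apply: sub_rect; clear -s0; lra.
have sc : square c (s / 2) c by apply: square_near; rewrite subrr normc0 divr_ge0 // ltW.
have far z : rect_bd (re c - s / 2) (re c + s / 2) (im c - s / 2)
    (im c + s / 2) z -> s / 2 <= normc (z - c).
  move=> [_ zb]; have [H|H] : s / 2 <= `|re z - re c| \/ s / 2 <= `|im z - im c|.
  - by case: zb => E; [left|left|right|right]; rewrite E ler_normr; apply/orP;
      clear; first [left; lra | right; lra].
  - by apply: le_trans H _; rewrite -reB re_le_normc.
  - by apply: le_trans H _; rewrite -imB im_le_normc.
have step t : 0 < t -> t <= s / 2 ->
    normc ('D_1 f c * g c) <= B + t * (2 * K * N).
  move=> t0 ts; pose h : cplx R := mkc t 0.
  have h0 : h != 0.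
    by apply/eqP => /(congr1 (@re R)); rewrite !reimE => /eqP; rewrite gt_eqF.
  have nh : normc h = t by rewrite normc_re ger0_norm // ltW.
  have s_h z : square c (s / 2) z -> square c s (z + h).
    move=> [/andP[z1 z2] /andP[z3 z4]].
    split; rewrite !reimE; clear -z1 z2 z3 z4 t0 ts; apply/andP; split; lra.
  pose F z := (f (z + h) - f z) * (h^-1 * g z).
  have FE z : square c (s / 2) z ->
      normc (F z - 'D_1 f z * g z) <= t * (K * N).
    move=> sz; rewrite /F slopeE.
    have -> : slope f z (z + h) * (z + h - z) * (h^-1 * g z) - 'D_1 f z * g z =
      (slope f z (z + h) - 'D_1 f z) * g z.
      by rewrite addrAC subrr add0r; field.
    rewrite normcM -slope_id mulrA.
    apply: ler_pM; rewrite ?normc_ge0 //; last by apply: HN; exact: s_sub.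
    have := HK z z (z + h) (s_sub _ sz) (s_sub _ sz) (s_h _ sz).
    by rewrite addrAC subrr add0r nh mulrC.
  have dF z : square c (s / 2) z -> derivable F z 1.
    move=> sz.
    have s2 w : square c s w -> square c (2 * s) w.
      by apply: sub_rect; clear -s0; lra.
    apply: (@derivableM _ _ (fun z => f (z + h) - f z) (fun z => h^-1 * g z)).
      apply: (@derivableB _ _ _ (fun z => f (z + h)) f); last first.
        by apply: df; apply: s2; exact: s_sub.
      have dsh : derivable (fun w : cplx R => w + h) z 1.
        apply: (@derivableD _ _ _ id (cst h)); first exact: derivable_id.
        exact: derivable_cst.
      exact: (derivable_cplx_comp dsh (df _ (s2 _ (s_h _ sz)))).
    apply: (@derivableM _ _ (cst h^-1) g); first exact: derivable_cst.
    by apply: dg; exact: s_sub.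
  have cin : rect_in (re c - s / 2) (re c + s / 2) (im c - s / 2)
    (im c + s / 2) c by clear -s0; split; apply/andP; split; lra.
  have Fb z : rect_bd (re c - s / 2) (re c + s / 2) (im c - s / 2)
      (im c + s / 2) z -> normc (F z) <= B + t * (K * N).
    move=> zb; have [zr _] := zb.
    have := FE _ zr; have := HB _ (s_sub _ zr) (far _ zb).
    by have := normc_tri (F z) ('D_1 f z * g z); clear; lra.
  have := max_modulus_rect cin dF Fb; have := FE _ sc; rewrite normcC.
  have := normc_tri ('D_1 f c * g c) (F c).
  by clear; lra.
apply/ler_addgt0Pr => e e0.
have KN : 0 < 2 * K * N by rewrite !mulr_gt0.
pose t := Num.min (s / 2) (e / (2 * K * N)).
have t0 : 0 < t by rewrite lt_min !divr_gt0.
have ts : t <= s / 2 by rewrite ge_min lexx.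
apply: le_trans (step t t0 ts) _; rewrite lerD2l -ler_pdivlMr //.
by rewrite ge_min lexx orbT.
Qed.

End DerivativeRegularity.


(** * Ahlfors' lemma *)

Section Ahlfors.
Variable R : realType.
Implicit Types (f g k : cplx R -> cplx R) (s e r : R) (a b z w c : cplx R).

Definition cconj z : cplx R := mkc (re z) (- im z).

Lemma re_cconj z : re (cconj z) = re z. Proof. by []. Qed.
Lemma im_cconj z : im (cconj z) = - im z. Proof. by []. Qed.
Definition cconjE := (re_cconj, im_cconj).

Lemma normc_cconj z : normc (cconj z) = normc z.
Proof. by rewrite !normc_reim !cconjE sqrrN. Qed.

(** With [psi = r (z - w) / (r^2 - conj w z)], the automorphism of the disk of
    radius [r] carrying [w] to the centre of the unit disk, these identities
    compute [1 - |psi|^2] after multiplication by the squared denominator. *)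
Lemma pick_identity r z w :
  normc (mkc (r ^+ 2) 0 - cconj w * z) ^+ 2 - (r * normc (z - w)) ^+ 2 =
  (r ^+ 2 - normc z ^+ 2) * (r ^+ 2 - normc w ^+ 2).
Proof. by rewrite exprMn !sqr_normcE !(reimE, cconjE); ring. Qed.

Lemma pick_identity1 z w :
  normc (1 - cconj w * z) ^+ 2 - normc (z - w) ^+ 2 =
  (1 - normc z ^+ 2) * (1 - normc w ^+ 2).
Proof. by rewrite !sqr_normcE !(reimE, cconjE); ring. Qed.

Lemma support_bound (m m' eta K T x y : R) :
  1 < m' -> 0 <= eta -> eta <= y -> y < 1 -> m' * y <= x ->
  (1 - x) / (1 - y) <= 1 - (m' - 1) * eta.
Proof.
move=> m1 e0 ey y1 xy; rewrite ler_pdivrMr; last by rewrite subr_gt0.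
have : 0 <= (m' - 1) * (y - eta + eta * y).
  apply: mulr_ge0; first by rewrite subr_ge0 ltW.
  by apply: addr_ge0; [rewrite subr_ge0|rewrite mulr_ge0 // (le_trans e0)].
lra.
Qed.

(** The hypotheses say that [k], as a map from the disk of radius [r] to the unit
    disk, stretches hyperbolic lengths by at most [m] near [w0], and by exactly
    [m > 1] at [w0]. Let [phi] and [psi] be the automorphisms carrying [k w0] and
    [w0] to the centre, and [x = |phi|^2] at [k w], [y = |psi|^2] at [w]. The
    function [k' (N / P)^2] formed with their denominators has, relative to its
    value at [w0], modulus at most [(1 - x) / (1 - y)]. As [m > 1], [x] is at
    least [m' y] near [w0] with [m' > 1], so this is less than 1 by a fixed amount
    at a fixed distance from [w0], against the maximum principle. *)
Lemma no_interior_max k w0 r m d : 0 < r -> normc w0 < r -> 0 < d -> 1 < m ->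
  (forall w, normc (w - w0) < d -> derivable k w 1 /\ normc (k w) < 1) ->
  (forall w, normc (w - w0) < d -> normc w < r ->
     normc ('D_1 k w) / (1 - normc (k w) ^+ 2) <= m * r / (r ^+ 2 - normc w ^+ 2)) ->
  normc ('D_1 k w0) / (1 - normc (k w0) ^+ 2) = m * r / (r ^+ 2 - normc w0 ^+ 2) ->
  False.
Proof.
move=> r0 w0r d0 m1 Hk Hle Heq.
pose k0 := k w0.
have [dk0 k01] : derivable k w0 1 /\ normc k0 < 1.
  by apply: Hk; rewrite subrr normc0.
pose N w := mkc (r ^+ 2) 0 - cconj w0 * w.
pose P w := 1 - cconj k0 * k w.
have n0 z : 0 <= normc z by exact: normc_ge0.
have sq1 (u v : R) : 0 <= u -> u < v -> u ^+ 2 < v ^+ 2.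
  by move=> u0 uv; rewrite ltrXn2r // ltW // (le_lt_trans u0).
have kk w : normc (w - w0) < d -> normc (k w) ^+ 2 < 1.
  by move=> /Hk[_ kw]; rewrite -(expr1n _ 2) sq1.
have P0 w : normc (w - w0) < d -> 0 < normc (P w).
  move=> wd; have := pick_identity1 (k w) k0; rewrite -/(P w) => E.
  have H1 : 0 < (1 - normc (k w) ^+ 2) * (1 - normc k0 ^+ 2).
    by rewrite mulr_gt0 // subr_gt0; apply: kk => //; rewrite subrr normc0.
  rewrite lt_def n0 andbT; apply/eqP => Pw.
  by move: H1; rewrite -E Pw expr0n /=; have := sqr_ge0 (normc (k w - k0)); clear; lra.
have N0 w : normc w < r -> 0 < normc (N w).
  move=> wr; have := pick_identity r w w0; rewrite -/(N w) => E.
  have H1 : 0 < (r ^+ 2 - normc w ^+ 2) * (r ^+ 2 - normc w0 ^+ 2).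
    by rewrite mulr_gt0 // subr_gt0 sq1.
  rewrite lt_def n0 andbT; apply/eqP => Nw.
  by move: H1; rewrite -E Nw expr0n /=; have := sqr_ge0 (r * normc (w - w0)); clear; lra.
have dw0 : normc (w0 - w0) < d by rewrite subrr normc0.
have a0 : 0 < 1 - normc k0 ^+ 2 by rewrite subr_gt0 kk.
have b0 : 0 < r ^+ 2 - normc w0 ^+ 2 by rewrite subr_gt0 sq1.
(* [|q w| = r |phi| / |psi|] for [w != w0] *)
pose q w := slope k w0 w * (N w / P w).
have dN w : derivable N w 1.
  apply: (@derivableB _ _ _ (cst (mkc (r ^+ 2) 0)) (fun w => cconj w0 * w)).
    exact: derivable_cst.
  apply: (@derivableM _ _ (cst (cconj w0)) id); first exact: derivable_cst.
  exact: derivable_id.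
have dP w : normc (w - w0) < d -> derivable P w 1.
  move=> /Hk[dkw _].
  apply: (@derivableB _ _ _ (cst (1 : cplx R)) (fun w => cconj k0 * k w)).
    exact: derivable_cst.
  by apply: (@derivableM _ _ (cst (cconj k0)) k); [exact: derivable_cst|exact: dkw].
have dNP w : normc (w - w0) < d -> derivable (fun w => N w / P w) w 1.
  move=> wd; apply: (@derivableM _ _ N (fun w => (P w)^-1)); first exact: dN.
  apply: derivableV; last exact: dP.
  by rewrite -normc_gt0 P0.
have Nw0 : normc (N w0) = r ^+ 2 - normc w0 ^+ 2.
  apply/eqP; rewrite -(@eqrXn2 _ 2) ?n0 ?(ltW b0) //.
  by have := pick_identity r w0 w0; rewrite subrr normc0 mulr0 expr0n subr0 => ->; rewrite -expr2.
have Pw0 : normc (P w0) = 1 - normc k0 ^+ 2.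
  apply/eqP; rewrite -(@eqrXn2 _ 2) ?n0 ?(ltW a0) //.
  by have := pick_identity1 k0 k0; rewrite subrr normc0 expr0n subr0 => ->; rewrite -expr2.
have D0 : normc ('D_1 k w0) = m * r * (1 - normc k0 ^+ 2) / (r ^+ 2 - normc w0 ^+ 2).
  by rewrite mulrAC -Heq divfK // gt_eqF.
have cq : {for w0, continuous q}.
  apply: (@continuousM _ _ (slope k w0) (fun w => N w / P w)).
    by apply: continuous_slope; exact: dk0.
  by apply: cplx_derivable_continuous; exact: dNP.
have q0 : normc (q w0) = m * r.
  rewrite /q slope_id normcM normcf Nw0 Pw0 D0.
  by field; rewrite !gt_eqF.
pose m' := (1 + m) / 2.
have m'1 : 1 < m' by rewrite /m'; clear -m1; lra.
have m'm : m' < m by rewrite /m'; clear -m1; lra.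
have [dq dq0 Hq] : exists2 dq : R, 0 < dq & forall w, normc (w - w0) < dq ->
    m' * r <= normc (q w).
  have e0 : 0 < (m - m') * r by rewrite mulr_gt0 // subr_gt0.
  have [dq dq0 H] := (continuous_cplxP _ _).1 cq _ e0; exists dq => // w /H.
  by have := normc_tri (q w0) (q w); rewrite normcC q0; clear; lra.
pose del := Num.min d (Num.min dq (r - normc w0)).
have del0 : 0 < del by rewrite !lt_min d0 dq0 subr_gt0.
pose s := del / 5; have s0 : 0 < s by rewrite divr_gt0.
have near w : square w0 (2 * s) w -> [/\ normc (w - w0) < d,
    m' * r <= normc (q w) & normc w < r].
  move=> /square_dist H; have : normc (w - w0) < del.
    by apply: le_lt_trans H _; rewrite /s; clear -del0; lra.
  rewrite !lt_min => /and3P[h1 h2 h3]; split=> //; first exact: Hq.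
  by have := normc_tri w w0; clear -h3; lra.
have s_sub w : square w0 s w -> square w0 (2 * s) w.
  by apply: sub_rect; clear -s0; lra.
pose G w := (N w / P w) ^+ 2.
pose eta := (s / (4 * r)) ^+ 2.
have eta0 : 0 < eta by rewrite exprn_gt0 // divr_gt0 // mulr_gt0.
set A := normc k0 ^+ 2 in a0 Pw0 D0; set B := r ^+ 2 - normc w0 ^+ 2 in b0 Nw0 D0.
pose C := m * r * (B / (1 - A)).
have C0 : 0 < C.
  by rewrite mulr_gt0 ?divr_gt0 // mulr_gt0 // (lt_trans ltr01).
have FE : normc ('D_1 k w0 * G w0) = C.
  rewrite normcM normcX normcf Nw0 Pw0 D0 /C.
  by field; rewrite !gt_eqF.
suff : normc ('D_1 k w0 * G w0) <= C * (1 - (m' - 1) * eta).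
  have H : 0 < C * ((m' - 1) * eta) by apply: (mulr_gt0 C0 (mulr_gt0 _ eta0)); rewrite subr_gt0.
  by rewrite FE; clear -H; lra.
apply: (@max_modulus_derive _ k G w0 s _ s0).
- by move=> w /near[wd _ _]; case: (Hk _ wd).
- move=> w /s_sub/near[wd _ _].
  by apply: derivable_expfun; exact: dNP.
move=> w /s_sub/near[wd qw wr] ws.
have Pw := P0 _ wd; have Nw := N0 _ wr.
have E1 := pick_identity1 (k w) k0; rewrite -/(P w) -/A in E1.
have E2 := pick_identity r w w0; rewrite -/(N w) -/B in E2.
pose x := (normc (k w - k0) / normc (P w)) ^+ 2.
pose y := (r * normc (w - w0) / normc (N w)) ^+ 2.
have kw1 := kk _ wd.
have wr2 : normc w ^+ 2 < r ^+ 2 by rewrite sq1.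
have xE : 1 - x = (1 - normc (k w) ^+ 2) * (1 - A) / normc (P w) ^+ 2.
  by rewrite -E1 /x; field; rewrite gt_eqF.
have yE : 1 - y = (r ^+ 2 - normc w ^+ 2) * B / normc (N w) ^+ 2.
  by rewrite -E2 /y; field; rewrite gt_eqF.
have y1 : y < 1.
  by rewrite -subr_gt0 yE divr_gt0 ?exprn_gt0 // mulr_gt0 // subr_gt0.
have ey : eta <= y.
  apply: lerXn2r.
  - exact: divr_ge0 (ltW s0) (mulr_ge0 (ler0n _ 4) (ltW r0)).
  - exact: divr_ge0 (mulr_ge0 (ltW r0) (n0 _)) (n0 _).
  rewrite ler_pdivlMr // mulrAC ler_pdivrMr ?mulr_gt0 //.
  have NB : normc (N w) <= 2 * r ^+ 2.
    apply: le_trans (normcB _ _) _; rewrite normcM normc_cconj normc_re.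
    rewrite ger0_norm ?sqr_ge0 // mulr_natl mulr2n lerD2l expr2.
    by apply: ler_pM => //; exact: ltW.
  apply: (@le_trans _ _ (s * (2 * r ^+ 2))); first by rewrite ler_wpM2l // ltW.
  rewrite [leLHS](_ : _ = s / 2 * (4 * r * r)); last by field.
  rewrite [leRHS](_ : _ = normc (w - w0) * (4 * r * r)); last by ring.
  by rewrite ler_wpM2r // !mulr_ge0 // ltW.
have xy : m' * y <= x.
  have H : m' * (r * normc (w - w0) / normc (N w)) <= normc (k w - k0) / normc (P w).
    rewrite ler_pdivlMr // slopeE normcM.
    have -> : m' * (r * normc (w - w0) / normc (N w)) * normc (P w) =
      (m' * r) * (normc (w - w0) * normc (P w) / normc (N w)) by ring.
    have -> : normc (slope k w0 w) * normc (w - w0) =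
      normc (q w) * (normc (w - w0) * normc (P w) / normc (N w)).
      by rewrite /q normcM normcf; field; rewrite !gt_eqF.
    by rewrite ler_wpM2r // divr_ge0 ?mulr_ge0.
  apply: (@le_trans _ _ ((m' * (r * normc (w - w0) / normc (N w))) ^+ 2)).
    rewrite exprMn ler_wpM2r ?sqr_ge0 // expr2 ler_peMl // ltW //.
    by apply: lt_trans m'1.
  apply: lerXn2r; last exact: H.
    apply: mulr_ge0; first by rewrite ltW // (lt_trans ltr01).
    exact: divr_ge0 (mulr_ge0 (ltW r0) (n0 _)) (n0 _).
  exact: divr_ge0 (n0 _) (n0 _).
apply: (@le_trans _ _ (C * ((1 - x) / (1 - y)))); last first.
  by rewrite ler_wpM2l ?(ltW C0) //; apply: support_bound => //; exact: ltW.
have -> : C * ((1 - x) / (1 - y)) = m * r / (r ^+ 2 - normc w ^+ 2) *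
    (1 - normc (k w) ^+ 2) * (normc (N w) / normc (P w)) ^+ 2.
  rewrite xE yE /C; field.
  by rewrite !gt_eqF // subr_gt0.
rewrite normcM normcX normcf ler_wpM2r ?sqr_ge0 //.
rewrite -ler_pdivrMr ?subr_gt0 //; exact: Hle.
Qed.

End Ahlfors.


Section AhlforsLemma.
Variable R : realType.
Implicit Types (k : cplx R -> cplx R) (r d : R) (w : cplx R).

Lemma compact_disk r : compact [set w : cplx R | normc w <= r].
Proof.
apply: (@subclosed_compact _ _ (rect (- r) r (- r) r)).
- have -> : [set w : cplx R | normc w <= r] =
    (fun w : cplx R => normc w) @^-1` [set x | x <= r] by [].
  apply: closed_comp; last exact: closed_le.
  by move=> w _; exact: continuous_normc.
- exact: compact_rect.
- move=> w /= wr; have := le_trans (re_le_normc w) wr.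
  have := le_trans (im_le_normc w) wr; rewrite !ler_norml => h1 h2.
  by split.
Qed.

(** [mu] is touched from below at [w0] by the pull-back of the hyperbolic density
    of the disk under a holomorphic map [k]. *)
Definition poincare_support (mu : cplx R -> R) (w0 : cplx R) := exists k d,
  [/\ 0 < d,
      forall w, normc (w - w0) < d -> derivable k w 1 /\ normc (k w) < 1,
      forall w, normc (w - w0) < d ->
        normc ('D_1 k w) / (1 - normc (k w) ^+ 2) <= mu w &
      normc ('D_1 k w0) / (1 - normc (k w0) ^+ 2) = mu w0].

(** Otherwise [mu w (r^2 - |w|^2)] exceeds [r] somewhere for some [r < 1]. It
    vanishes on the circle of radius [r], so that its maximum is attained inside,
    and there the supporting map contradicts [no_interior_max]. *)
Theorem ahlfors_lemma (mu : cplx R -> R) :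
  (forall w, unit_disk w -> {for w, continuous mu}) ->
  (forall w, unit_disk w -> poincare_support mu w) ->
  forall w, unit_disk w -> mu w * (1 - normc w ^+ 2) <= 1.
Proof.
move=> cmu smu w1 w1D; rewrite leNgt; apply/negP => big.
pose rho := normc w1.
have rho0 : 0 <= rho by exact: normc_ge0.
have rho1 : rho < 1 by exact: w1D.
have sq1 (u v : R) : 0 <= u -> u < v -> u ^+ 2 < v ^+ 2.
  by move=> u0 uv; rewrite ltrXn2r // ltW // (le_lt_trans u0).
have [r rr [r1 rbig]] : exists2 r, rho < r & r < 1 /\ r < mu w1 * (r ^+ 2 - rho ^+ 2).
  have d0 : 0 < 1 - rho ^+ 2 by rewrite subr_gt0 -(expr1n _ 2) sq1.
  have mu0 : 0 < mu w1.
    by rewrite -(pmulr_lgt0 _ d0); exact: lt_trans big.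
  pose t := Num.min ((1 - rho) / 2)
    ((mu w1 * (1 - rho ^+ 2) - 1) / (2 * mu w1)).
  have t0 : 0 < t.
    by rewrite lt_min !divr_gt0 ?subr_gt0 // mulr_gt0.
  have [t1 t2] : t <= (1 - rho) / 2 /\ t <= (mu w1 * (1 - rho ^+ 2) - 1) / (2 * mu w1).
    by rewrite /t; split; rewrite ge_min lexx ?orbT.
  exists (1 - t); first by clear -t1 rho1; lra.
  split; first by clear -t0; lra.
  move: t2; rewrite ler_pdivlMr ?mulr_gt0 // => t2.
  have : 0 <= mu w1 * t ^+ 2 by rewrite mulr_ge0 ?sqr_ge0 // ltW.
  by clear -t2 t0 mu0; lra.
have r0 : 0 < r by apply: le_lt_trans rr.
have in_disk w : normc w <= r -> unit_disk w.
  by move=> wr; rewrite /unit_disk /=; exact: le_lt_trans r1.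
pose U w := mu w * (r ^+ 2 - normc w ^+ 2).
pose K := [set w : cplx R | normc w <= r].
have K0 : K !=set0 by exists w1; exact: ltW.
have cU : {within K, continuous U}.
  apply: continuous_in_subspaceT => w; rewrite inE => /= /in_disk wD.
  apply: (@continuousM _ _ mu (fun w => r ^+ 2 - normc w ^+ 2)).
    exact: cmu.
  apply: (@continuousB _ _ _ (fun=> r ^+ 2) (fun w => normc w ^+ 2)).
    exact: cst_continuous.
  apply: (@continuousM _ _ (fun w : cplx R => normc w) (fun w : cplx R => normc w));
    exact: continuous_normc.
have [w0 w0K Hmax] := compact_EVT_max K0 (@compact_disk r) cU.
have Uw0 : r < U w0.
  by apply: lt_le_trans rbig _; apply: Hmax; rewrite inE; exact: ltW.
rewrite inE /= in w0K.
have w0r : normc w0 < r.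
  rewrite lt_neqAle w0K andbT; apply/eqP => E.
  by move: Uw0; rewrite /U E subrr mulr0 ltNge (ltW r0).
have [k [d [d0 Hk Hle Heq]]] := smu w0 (in_disk _ w0K).
have b0 w : normc w < r -> 0 < r ^+ 2 - normc w ^+ 2.
  by move=> wr; rewrite subr_gt0 sq1 // normc_ge0.
apply: (@no_interior_max _ k w0 r (U w0 / r) d) => //.
- by rewrite ltr_pdivlMr ?mul1r.
- move=> w wd wr; rewrite divfK ?gt_eqF //.
  apply: le_trans (Hle _ wd) _; rewrite ler_pdivlMr ?b0 //.
  by apply: Hmax; rewrite inE; exact: ltW.
- by rewrite divfK ?gt_eqF // Heq /U mulfK // gt_eqF // b0.
Qed.

End AhlforsLemma.


(** * Exponential and logarithm *)

Section ExpLog.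
Variable R : realType.
Implicit Types (z w a : cplx R) (x y e d : R) (f g : cplx R -> cplx R).

Lemma is_derive_inverse f g a (l : cplx R) d : 0 < d ->
  (forall w, normc (w - a) < d -> f (g w) = w) ->
  {for a, continuous g} -> is_derive (g a) (1 : cplx R) f l -> l != 0 ->
  is_derive a (1 : cplx R) g l^-1.
Proof.
move=> d0 fgK cg df l0.
pose q u := if u == g a then l else (f u - f (g a)) / (u - g a).
have fq u : f u - f (g a) = q u * (u - g a).
  rewrite /q; case: eqVneq => [->|ua]; first by rewrite !subrr mulr0.
  by rewrite divfK // subr_eq0.
have qa : q (g a) = l by rewrite /q eqxx.
have cq : {for a, continuous (q \o g)}.
  by apply: continuous_comp; [exact: cg|exact: (is_derive_slope df)].
have nl : 0 < normc l by rewrite normc_gt0.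
have [r r0 Hr] := (continuous_cplxP _ _).1 cq _ nl.
have q0 w : normc (w - a) < r -> q (g w) != 0.
  move=> /Hr /=; rewrite qa; apply: contraTneq => ->.
  by rewrite sub0r normcN ltxx.
pose G w := g a + (q (g w))^-1 * (w - a).
have GE w : G w - G a = (q (g w))^-1 * (w - a).
  by rewrite /G subrr mulr0 addr0 addrAC subrr add0r.
have cqV : {for a, continuous (fun w => (q (g w))^-1)}.
  by apply: (@continuousV _ _ (q \o g)); [rewrite /= qa|exact: cq].
have := is_derive_caratheodory GE cqV; rewrite qa.
apply: (@is_derive_near_eq _ _ _ _ _ (Num.min r d)); first by rewrite lt_min r0.
move=> w; rewrite lt_min => /andP[wr wd].
have gw : w - a = q (g w) * (g w - g a).
  by rewrite -fq fgK // fgK // subrr normc0.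
by rewrite /G gw mulKf ?q0 // addrC subrK.
Qed.

Lemma is_derive_realP (f : R -> R) x l : is_derive x (1 : R) f l ->
  forall e, 0 < e -> exists2 d, 0 < d & forall t, `|t - x| < d ->
    `|f t - f x - l * (t - x)| <= e * `|t - x|.
Proof.
move=> df e e0; have [dfx dl] := df.
pose q (h : R) : R := h^-1 *: ((f \o shift x) (h *: 1) - f x).
have cq : q @ 0^' --> l by rewrite -dl; exact: dfx.
have /cq : nbhs l [set w | `|w - l| < e].
  by apply/nbhs_ballP; exists e => // w; rewrite /ball /= distrC.
move=> /nbhs_ballP[d /= d0 Hd]; exists d => // t td.
have [->|tx] := eqVneq t x; first by rewrite !subrr mulr0 subr0 normr0 mulr0.
have tx0 : t - x != 0 by rewrite subr_eq0.
have := Hd (t - x); rewrite /ball /= sub0r normrN => /(_ td tx0).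
rewrite /q /= [_%:A]mulr1 subrK.
have -> : (t - x)^-1 *: (f t - f x) - l = (f t - f x - l * (t - x)) / (t - x).
  by rewrite [RHS]mulrBl mulfK // mulrC.
by rewrite normf_div ltr_pdivrMr ?normr_gt0 // => /ltW.
Qed.

Definition cexp z : cplx R :=
  mkc (expR (re z) * cos (im z)) (expR (re z) * sin (im z)).

Lemma cexpD z w : cexp (z + w) = cexp z * cexp w.
Proof.
by apply: cplxP; rewrite /cexp !reimE expRD ?cosD ?sinD; ring.
Qed.

Lemma cexp0 : cexp 0 = 1.
Proof. by apply: cplxP; rewrite /cexp !reimE expR0 ?cos0 ?sin0 mul1r. Qed.

Lemma normc_cexp z : normc (cexp z) = expR (re z).
Proof.
apply/eqP; rewrite -(@eqrXn2 _ 2) ?normc_ge0 ?expR_ge0 //.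
by rewrite sqr_normcE !reimE !exprMn -mulrDr cos2Dsin2 mulr1.
Qed.

Lemma cexp_neq0 z : cexp z != 0.
Proof. by rewrite -normc_gt0 normc_cexp expR_gt0. Qed.

Lemma cexpN z : cexp (- z) = (cexp z)^-1.
Proof.
apply: (mulIf (cexp_neq0 z)).
by rewrite -cexpD addNr cexp0 mulVf // cexp_neq0.
Qed.

(** With [z = x + i y], split [e^x cos y - 1 - x] as
    [e^x (cos y - 1) + (e^x - 1 - x)], and [e^x sin y - y] as
    [e^x (sin y - y) + (e^x - 1) y]. *)
Lemma is_derive_cexp0 : is_derive (0 : cplx R) (1 : cplx R) cexp 1.
Proof.
apply/is_derive_cplxP => e e0.
have e8 : 0 < e / 8 by rewrite divr_gt0.
have [d1 d10 H1] := is_derive_realP (is_derive_expR (0 : R)) e8.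
have [d2 d20 H2] := is_derive_realP (is_derive_cos (0 : R)) e8.
have [d3 d30 H3] := is_derive_realP (is_derive_sin (0 : R)) e8.
have c1 : 0 < 1 :> R by [].
have [d4 d40 H4] := is_derive_realP (is_derive_expR (0 : R)) c1.
pose d := Num.min (Num.min d1 d2) (Num.min (Num.min d3 d4)
  (Num.min (e / 8) (1 / 2))).
exists d.
  by rewrite !lt_min d10 d20 d30 d40 e8 /=; lra.
move=> z; rewrite subr0 cexp0 mul1r !lt_min.
move=> /andP[/andP[z1 z2] /andP[/andP[z3 z4] /andP[z5 z6]]].
set x := re z; set y := im z; set n := normc z in z1 z2 z3 z4 z5 z6 *.
have xn : `|x| <= n by exact: re_le_normc.
have yn : `|y| <= n by exact: im_le_normc.
have := H1 x; rewrite subr0 expR0 mul1r => /(_ (le_lt_trans xn z1)) {}H1.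
have := H4 x; rewrite subr0 expR0 mul1r => /(_ (le_lt_trans xn z4)) {}H4.
have := H2 y; rewrite subr0 cos0 sin0 oppr0 mul0r subr0 => /(_ (le_lt_trans yn z2)) {}H2.
have := H3 y; rewrite subr0 sin0 cos0 mul1r subr0 => /(_ (le_lt_trans yn z3)) {}H3.
apply: le_trans (normc_le_reim _) _; rewrite /cexp !reimE -/x -/y.
set E := expR x in H1 H4 *; set C := cos y in H2 *; set S := sin y in H3 *.
rewrite subr0.
have n0 : 0 <= n by exact: normc_ge0.
have E0 : 0 <= E by exact: expR_ge0.
have E1 : `|E - 1| <= 2 * n.
  have := ler_normD (E - 1 - x) x; rewrite subrK.
  by clear -H4 xn; lra.
have E2 : E <= 2 by move: E1; rewrite ler_norml => /andP[_]; clear -z6; lra.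
have A1 : `|E * C - 1 - x| <= 2 * (e / 8 * n) + e / 8 * n.
  have -> : E * C - 1 - x = E * (C - 1) + (E - 1 - x) by ring.
  apply: le_trans (ler_normD _ _) _; apply: lerD.
    rewrite normrM (ger0_norm E0); apply: ler_pM => //.
    by apply: le_trans H2 _; rewrite ler_wpM2l // ltW.
  by apply: le_trans H1 _; rewrite ler_wpM2l // ltW.
have A2 : `|E * S - y| <= 2 * (e / 8 * n) + 2 * n * n.
  have -> : E * S - y = E * (S - y) + (E - 1) * y by ring.
  apply: le_trans (ler_normD _ _) _; apply: lerD.
    rewrite normrM (ger0_norm E0); apply: ler_pM => //.
    by apply: le_trans H3 _; rewrite ler_wpM2l // ltW.
  by rewrite normrM; apply: ler_pM.
have A3 : 2 * n * n <= 2 * (e / 8 * n).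
  by rewrite -mulrA ler_wpM2l // ler_wpM2r // ltW.
have A4 : 0 <= e * n by rewrite mulr_ge0 // ltW.
by move: A1 A2 A3 A4; clear; lra.
Qed.

Lemma is_derive_cexp z : is_derive z (1 : cplx R) cexp (cexp z).
Proof.
apply/is_derive_cplxP => e e0.
have n0 : 0 < normc (cexp z) by rewrite normc_gt0 cexp_neq0.
have en : 0 < e / normc (cexp z) by rewrite divr_gt0.
have [d d0 Hd] := (is_derive_cplxP _ _ _).1 is_derive_cexp0 _ en.
exists d => // w wd.
have := Hd (w - z); rewrite subr0 => /(_ wd); rewrite cexp0 mul1r => H.
have -> : cexp w - cexp z - cexp z * (w - z) =
  cexp z * (cexp (w - z) - 1 - (w - z)).
  have -> : cexp w = cexp (w - z) * cexp z by rewrite -cexpD subrK.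
  by ring.
rewrite normcM; apply: le_trans (ler_wpM2l (ltW n0) H) _.
by rewrite le_eqVlt; apply/orP; left; apply/eqP; field; rewrite gt_eqF.
Qed.

(** The principal branch, on the right half plane only. *)
Definition clog z : cplx R := mkc (ln (normc z)) (atan (im z / re z)).

Lemma clogK z : 0 < re z -> cexp (clog z) = z.
Proof.
move=> x0; have z0 : 0 < normc z.
  by apply: lt_le_trans x0 _; apply: le_trans (ler_norm _) (re_le_normc _).
have cosE : cos (atan (im z / re z)) = re z / normc z.
  rewrite cos_atan normc_reim; set x := re z in x0 *; set y := im z.
  have -> : x ^+ 2 + y ^+ 2 = x ^+ 2 * (1 + (y / x) ^+ 2).
    by field; rewrite gt_eqF.
  by rewrite sqrtrM ?sqr_ge0 // sqrtr_sqr ger0_norm ?ltW // invfM mulrA divff ?mul1r // gt_eqF.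
have sinE : sin (atan (im z / re z)) = im z / normc z.
  have := atanK (im z / re z); rewrite /tan cosE => H.
  have c0 : re z / normc z != 0 by rewrite mulf_neq0 ?invr_neq0 // gt_eqF.
  rewrite -[LHS](divfK c0) H; field; rewrite !gt_eqF //.
have pz : normc z \is Num.pos by rewrite posrE.
apply: cplxP; rewrite /cexp /clog !reimE lnK //.
  by rewrite cosE mulrC divfK // gt_eqF.
by rewrite sinE mulrC divfK // gt_eqF.
Qed.

Lemma clog1 : clog 1 = 0.
Proof. by apply: cplxP; rewrite /clog !reimE ?normc1 ?ln1 // mul0r atan0. Qed.

Lemma continuous_clog z : 0 < re z -> {for z, continuous clog}.
Proof.
move=> x0; have z0 : 0 < normc z.
  by apply: lt_le_trans x0 _; apply: le_trans (ler_norm _) (re_le_normc _).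
have cre : {for z, continuous (fun w : cplx R => ln (normc w))}.
  apply: (@continuous_comp _ _ _ (fun w : cplx R => normc w) (@ln R)).
    exact: continuous_normc.
  exact: continuous_ln.
have cim : {for z, continuous (fun w : cplx R => atan (im w / re w))}.
  apply: (@continuous_comp _ _ _ (fun w : cplx R => im w / re w) (@atan R)).
    apply: (@continuousM _ _ (@im R) (fun w => (re w)^-1)).
      exact: continuous_im.
    apply: (@continuousV _ _ (@re R)); first by rewrite gt_eqF.
    exact: continuous_re.
  exact: continuous_atan.
apply/continuous_cplxP => e e0.
have e2 : 0 < e / 2 by rewrite divr_gt0.
have [d1 d10 H1] := (continuous_cplx_realP _ _).1 cre _ e2.
have [d2 d20 H2] := (continuous_cplx_realP _ _).1 cim _ e2.
exists (Num.min d1 d2); first by rewrite lt_min d10.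
move=> w; rewrite lt_min => /andP[/H1 h1 /H2 h2].
apply: le_lt_trans (normc_le_reim _) _.
by rewrite reB imB /clog !re_mkc !im_mkc (splitr e) ltrD.
Qed.

Lemma is_derive_clog z : 0 < re z -> is_derive z (1 : cplx R) clog z^-1.
Proof.
move=> x0; rewrite -{2}(clogK x0).
apply: (@is_derive_inverse cexp clog z (cexp (clog z)) (re z)).
- exact: x0.
- move=> w wz; apply: clogK.
  have := le_lt_trans (re_le_normc _) wz; rewrite reB ltr_norml.
  by clear; lra.
- exact: continuous_clog.
- exact: is_derive_cexp.
- exact: cexp_neq0.
Qed.

Lemma polar_form z : z != 0 ->
  exists2 t : R, `|t| <= pi & z = cexp (mkc (ln (normc z)) t).
Proof.
move=> z0; have n0 : 0 < normc z by rewrite normc_gt0.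
pose u := re z / normc z.
have u1 : -1 <= u <= 1.
  by rewrite -ler_norml normf_div (ger0_norm (ltW n0)) ler_pdivrMr // mul1r re_le_normc.
have cosE : cos (acos u) = u by apply: acosK; rewrite in_itv.
have sinE : sin (acos u) = `|im z| / normc z.
  rewrite sin_acos //.
  have -> : 1 - u ^+ 2 = (im z / normc z) ^+ 2.
    rewrite /u !expr_div_n sqr_normcE; field.
    by rewrite -sqr_normcE sqrf_eq0 gt_eqF.
  by rewrite sqrtr_sqr normf_div (ger0_norm (ltW n0)).
have pz : normc z \is Num.pos by rewrite posrE.
have [y0|y0] := leP 0 (im z).
  exists (acos u); first by rewrite ger0_norm ?acos_ge0 ?acos_lepi.
  apply: cplxP; rewrite /cexp !reimE lnK // ?cosE ?sinE.
    by rewrite /u mulrC divfK // gt_eqF.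
  by rewrite ger0_norm // mulrC divfK // gt_eqF.
exists (- acos u); first by rewrite normrN ger0_norm ?acos_ge0 ?acos_lepi.
apply: cplxP; rewrite /cexp !reimE lnK // ?cosN ?sinN ?cosE ?sinE.
  by rewrite /u mulrC divfK // gt_eqF.
by rewrite ltr0_norm // mulNr opprK mulrC divfK // gt_eqF.
Qed.

(** Branch of [log (f / f a)] near [a], where [f / f a] is in the right half
    plane. *)
Lemma local_log f a d : 0 < d ->
  (forall w, normc (w - a) < d -> derivable f w 1) -> f a != 0 ->
  exists l : cplx R -> cplx R, exists2 r, 0 < r & r <= d /\ l a = 0 /\
    forall w, normc (w - a) < r -> [/\ f w != 0,
      is_derive w (1 : cplx R) l ('D_1 f w / f w) & cexp (l w) = f w / f a].
Proof.
move=> d0 df fa0.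
have cf : {for a, continuous f}.
  by apply: cplx_derivable_continuous; apply: df; rewrite subrr normc0.
have nf : 0 < normc (f a) by rewrite normc_gt0.
have [r r0 Hr] := (continuous_cplxP _ _).1 cf _ nf.
pose g w := f w / f a.
have gre w : normc (w - a) < r -> 0 < re (g w).
  move=> /Hr H; have : normc (g w - 1) < 1.
    have -> : g w - 1 = (f w - f a) / f a by rewrite /g mulrBl divff.
    by rewrite normcf ltr_pdivrMr // mul1r.
  move/(le_lt_trans (re_le_normc _)); rewrite reB re1 ltr_norml.
  by clear; lra.
exists (clog \o g); exists (Num.min r d); first by rewrite lt_min r0.
split; first by rewrite ge_min lexx orbT.
split; first by rewrite /= /g divff // clog1.
move=> w; rewrite lt_min => /andP[wr wd].
have gw := gre _ wr.
have fw0 : f w != 0.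
  by apply: contraTneq gw => E; rewrite /g E mul0r re0 ltxx.
split; [exact: fw0| |exact: clogK].
have dg : is_derive w (1 : cplx R) g ('D_1 f w / f a).
  have [q fq [cq qE]] := derivable_caratheodory (df _ wd).
  rewrite -qE; apply: (@is_derive_caratheodory _ g (fun z => q z / f a)).
    by move=> z; rewrite /g -mulrBl fq mulrAC.
  apply: (@continuousM _ _ q (cst (f a)^-1)); first exact: cq.
  exact: cst_continuous.
have := is_derive_cplx_comp dg (is_derive_clog gw).
by congr (is_derive _ _ _ _); rewrite /g; field; rewrite fw0 fa0.
Qed.

End ExpLog.


(** * Distance to the omitted set in the logarithmic coordinate *)

Section LogDistance.
Variables (R : realType) (E : set (cplx R)).
Hypothesis E_closed : closed E.
Implicit Types (z w l : cplx R) (x y e d : R).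

Definition log_omitted z : set R :=
  [set normc l | l in [set l | E (z * cexp (- l))]].
(** Distance from a logarithm of [z] to the set of all logarithms of points of
    [E]: [z * cexp (- l)] ranges over the points with logarithm [log z - l]. All
    branches are covered, so no branch is chosen. *)
Definition log_dist z : R := inf (log_omitted z).

Lemma log_dist_le z l : E (z * cexp (- l)) -> log_dist z <= normc l.
Proof.
move=> El; apply: ge_inf; last by exists l.
by exists 0 => _ [l' _ <-]; exact: normc_ge0.
Qed.

Lemma continuous_cexpN z : continuous (fun l => z * cexp (- l)).
Proof.
move=> l; apply: (@continuousM _ _ (cst z) (fun l => cexp (- l))).
  exact: cst_continuous.
apply: (@continuous_comp _ _ _ (fun l : cplx R => - l) (@cexp R)).
  by apply: (@continuousN _ _ _ id); exact: cvg_id.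
apply: cplx_derivable_continuous.
exact: (@ex_derive _ _ _ _ _ _ _ (is_derive_cexp _)).
Qed.

(** The infimum is over a closed set, and compactness of disks makes it a
    minimum. *)
Lemma log_dist_attained z : log_omitted z !=set0 ->
  exists2 l, E (z * cexp (- l)) & normc l = log_dist z.
Proof.
move=> [_ [l1 El1 _]].
pose A := [set l | E (z * cexp (- l))].
pose K := A `&` [set l : cplx R | normc l <= normc l1].
have cA : closed A.
  have -> : A = (fun l => z * cexp (- l)) @^-1` E by [].
  by apply: closed_comp => // l _; exact: continuous_cexpN.
have cK : compact K.
  apply: (@subclosed_compact _ _ [set l : cplx R | normc l <= normc l1]).
  - apply: closedI; first exact: cA.
    have -> : [set w : cplx R | normc w <= normc l1] =
      (fun w : cplx R => normc w) @^-1` [set x | x <= normc l1] by [].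
    apply: closed_comp; last exact: closed_le.
    by move=> w _; exact: continuous_normc.
  - exact: compact_disk.
  - by move=> l [].
have K0 : K !=set0 by exists l1; split => //=.
have cn : {within K, continuous (fun l : cplx R => normc l)}.
  by apply: continuous_in_subspaceT => l _; exact: continuous_normc.
have [l0 l0K Hmin] := compact_EVT_min K0 cK cn.
rewrite inE in l0K; have [El0 l0l1] := l0K; exists l0 => //.
apply/eqP; rewrite eq_le (log_dist_le El0) andbT.
apply: lb_le_inf; first by exists (normc l1), l1.
move=> _ [l El <-]; have [ll1|/ltW ll1] := leP (normc l) (normc l1).
  by apply: Hmin; rewrite inE.
exact: le_trans l0l1 ll1.
Qed.

(** The distance function to a set is 1-Lipschitz. *)
Lemma log_dist_shift z l : log_omitted z !=set0 ->
  log_omitted (z * cexp l) !=set0 /\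
  log_dist (z * cexp l) <= log_dist z + normc l.
Proof.
move=> /log_dist_attained [l0 El0 <-].
have El : E (z * cexp l * cexp (- (l0 + l))).
  by rewrite opprD cexpD mulrACA [cexp l * _]mulrC -cexpD addNr cexp0 mulr1.
split; first by exists (normc (l0 + l)), (l0 + l).
exact: le_trans (log_dist_le El) (normcD _ _).
Qed.

End LogDistance.

(** * A Landau-type bound in the logarithmic coordinate *)

Section Profile.
Variable R : realType.
Implicit Types x y t : R.

(** [|k| (1 - |k|^2)] in terms of [t = |k|^2]. *)
Definition sqrt_profile t : R := Num.sqrt t * (1 - t).

(** [a - a^3] increases up to [a = 1 / sqrt 3]. This is what makes the nearest
    omitted point give the largest metric. *)
Lemma sqrt_profile_incr x y : 0 <= x -> x <= y -> y <= 1 / 3 ->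
  sqrt_profile x <= sqrt_profile y.
Proof.
move=> x0 xy y3; have y0 := le_trans x0 xy.
rewrite /sqrt_profile -{2}(sqr_sqrtr x0) -{2}(sqr_sqrtr y0).
have ab : Num.sqrt x <= Num.sqrt y by rewrite ler_sqrt.
have b3 : Num.sqrt y ^+ 2 <= 1 / 3 by rewrite sqr_sqrtr.
have a0 := sqrtr_ge0 x.
set a := Num.sqrt x in ab a0 *; set b := Num.sqrt y in ab b3 *.
have h1 : 0 <= b - a by rewrite subr_ge0.
have h2 : a ^+ 2 <= b ^+ 2 by rewrite lerXn2r ?nnegrE // (le_trans a0).
have h3 : a * b <= b ^+ 2 by rewrite expr2 ler_wpM2r // (le_trans a0).
have h4 : 0 <= 1 - (a ^+ 2 + a * b + b ^+ 2) by clear -h2 h3 b3; lra.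
rewrite -subr_ge0 (_ : _ - _ = (b - a) * (1 - (a ^+ 2 + a * b + b ^+ 2))).
  exact: mulr_ge0.
by ring.
Qed.

Lemma sqrt_profile_le t : 0 <= t -> t <= 1 -> sqrt_profile t <= 2 / 5.
Proof.
move=> t0 t1; rewrite /sqrt_profile -{2}(sqr_sqrtr t0).
have a0 := sqrtr_ge0 t.
have a1 : Num.sqrt t <= 1 by rewrite -sqrtr1 ler_sqrt.
set a := Num.sqrt t in a0 a1 *.
(* tangent line at 4/7, a rational point close to the maximum 1/sqrt 3 *)
have : 0 <= (a - 4 / 7) ^+ 2 * (a + 8 / 7).
  by rewrite mulr_ge0 ?sqr_ge0 // addr_ge0.
clear -a1; lra.
Qed.

Lemma sqrt_profile_gt0 t : 0 < t -> t < 1 -> 0 < sqrt_profile t.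
Proof. by move=> t0 t1; rewrite mulr_gt0 ?sqrtr_gt0 // subr_gt0. Qed.

Lemma continuous_sqrt_profile : continuous sqrt_profile.
Proof.
move=> t; apply: (@continuousM _ _ (@Num.sqrt R) (fun t => 1 - t)).
  exact: sqrt_continuous.
apply: (@continuousB _ _ _ (cst (1 : R)) id); first exact: cst_continuous.
exact: cvg_id.
Qed.

End Profile.

Section LogLandau.
Variables (R : realType) (E : set (cplx R)) (D : R) (p : cplx R -> cplx R).
Hypothesis E_closed : closed E.
Hypothesis E0 : E 0.
Hypothesis D0 : 0 < D.
Hypothesis p_derivable : forall w, unit_disk w -> derivable p w 1.
Hypothesis p_omits : forall w, unit_disk w -> ~ E (p w).
Hypothesis p_near : forall w, unit_disk w ->
  exists2 l, normc l < D & E (p w * cexp (- l)).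
Implicit Types (w l : cplx R).

Let C := 3 * D.
Let C0 : 0 < C. Proof. by rewrite mulr_gt0. Qed.
Let D_lt_C : D < C. Proof. by rewrite /C; have := D0; lra. Qed.
Let dist w := log_dist E (p w).

(** The pull-back density [|h'| / (2 C sqrt t (1 - t))] for [h = log p], with
    [t C] the distance to the nearest omitted value. The factor 3 in [C] keeps
    [t] below 1/3. *)
Definition log_density w : R :=
  normc ('D_1 p w) / (normc (p w) * (2 * C * sqrt_profile (dist w / C))).

Lemma unit_disk_near w : unit_disk w -> exists2 d : R, 0 < d &
  forall z, normc (z - w) < d -> unit_disk z.
Proof.
rewrite /unit_disk /= => w1; exists (1 - normc w); first by rewrite subr_gt0.
move=> z zw; have := normc_tri z w; lra.
Qed.

Lemma p_neq0 w : unit_disk w -> p w != 0.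
Proof. by move=> wD; apply/eqP => pw; apply: (p_omits wD); rewrite pw. Qed.

Lemma omitted_ne w : unit_disk w -> log_omitted E (p w) !=set0.
Proof. by move=> /p_near[l _ El]; exists (normc l), l. Qed.

Lemma dist_lt w : unit_disk w -> dist w < D.
Proof.
by move=> /p_near[l lD El]; apply: le_lt_trans lD; exact: log_dist_le.
Qed.

Lemma dist_gt0 w : unit_disk w -> 0 < dist w.
Proof.
move=> wD; rewrite /dist.
have [l El <-] := log_dist_attained E_closed (omitted_ne wD).
rewrite normc_gt0; apply/eqP => l0; apply: (p_omits wD).
by move: El; rewrite l0 oppr0 cexp0 mulr1.
Qed.

Lemma profile_gt0 w : unit_disk w -> 0 < sqrt_profile (dist w / C).
Proof.
move=> wD; apply: sqrt_profile_gt0; first by rewrite divr_gt0 // dist_gt0.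
rewrite ltr_pdivrMr // mul1r; apply: lt_trans (dist_lt wD) _.
by rewrite /C; have := D0; lra.
Qed.

Lemma denom_gt0 w : unit_disk w ->
  0 < normc (p w) * (2 * C * sqrt_profile (dist w / C)).
Proof.
move=> wD; apply: mulr_gt0; first by rewrite normc_gt0 p_neq0.
by apply: mulr_gt0; [exact: mulr_gt0|exact: profile_gt0].
Qed.

Lemma p_local_log w0 : unit_disk w0 ->
  exists L : cplx R -> cplx R, exists2 r, 0 < r & L w0 = 0 /\
    forall w, normc (w - w0) < r -> [/\ unit_disk w,
      is_derive w (1 : cplx R) L ('D_1 p w / p w) & p w = p w0 * cexp (L w)].
Proof.
move=> wD; have [d d0 Hd] := unit_disk_near wD.
have [|L [r r0 [rd [L0 HL]]]] := @local_log _ p w0 d d0 _ (p_neq0 wD).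
  by move=> w /Hd; exact: p_derivable.
exists L, r => //; split=> // w wr; have [_ dL EL] := HL _ wr; split.
- by apply: Hd; exact: lt_le_trans rd.
- exact: dL.
- by rewrite EL mulrC divfK // p_neq0.
Qed.

Lemma continuous_dist w0 : unit_disk w0 -> {for w0, continuous dist}.
Proof.
move=> wD; have [L [r r0 [L0 HL]]] := p_local_log wD.
have cL : {for w0, continuous L}.
  apply: cplx_derivable_continuous.
  have [|_ dL _] := HL w0; first by rewrite subrr normc0.
  exact: (@ex_derive _ _ _ _ _ _ _ dL).
apply/continuous_cplx_realP => e e0.
have [d d0 Hd] := (continuous_cplxP _ _).1 cL _ e0.
exists (Num.min r d); first by rewrite lt_min r0.
move=> w; rewrite lt_min => /andP[/HL[wD' _ pw] /Hd].
rewrite L0 subr0 => Le; apply: le_lt_trans Le.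
have [_ le1] := log_dist_shift E_closed (L w) (omitted_ne wD).
have [_ le2] := log_dist_shift E_closed (- L w) (omitted_ne wD').
have pw' : p w * cexp (- L w) = p w0.
  by rewrite pw -mulrA -cexpD subrr cexp0 mulr1.
rewrite -pw in le1; rewrite pw' normcN in le2.
by rewrite ler_norml /dist; apply/andP; split; lra.
Qed.

Lemma continuous_log_density w0 : unit_disk w0 ->
  {for w0, continuous log_density}.
Proof.
move=> wD; have [d d0 Hd] := unit_disk_near wD.
have cp : {for w0, continuous p}.
  by apply: cplx_derivable_continuous; exact: p_derivable.
have cdp : {for w0, continuous (fun w => 'D_1 p w)}.
  have s0 : 0 < d / 5 by rewrite divr_gt0.
  apply: (continuous_derive s0) => z /square_dist zd; apply: p_derivable.
  by apply: Hd; apply: le_lt_trans zd _; lra.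
pose q w := normc (p w) * (2 * C * sqrt_profile (dist w / C)).
have cn f : {for w0, continuous f} ->
    {for w0, continuous (fun w : cplx R => normc (f w : cplx R))}.
  move=> cf; apply: (@continuous_comp _ _ _ f (fun z : cplx R => normc z)).
    exact: cf.
  exact: continuous_normc.
have cq : {for w0, continuous q}.
  apply: (@continuousM _ _ (fun w => normc (p w))
    (fun w => 2 * C * sqrt_profile (dist w / C))); first exact: cn.
  apply: (@continuousM _ _ (cst (2 * C)) (fun w => sqrt_profile (dist w / C))).
    exact: cst_continuous.
  apply: (@continuous_comp _ _ _ (fun w => dist w / C) (@sqrt_profile R)).
    apply: (@continuousM _ _ dist (cst C^-1)); first exact: continuous_dist.
    exact: cst_continuous.
  exact: continuous_sqrt_profile.
apply: (@continuousM _ _ (fun w => normc ('D_1 p w)) (fun w => (q w)^-1)).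
  exact: cn.
apply: (@continuousV _ _ q); last exact: cq.
by rewrite gt_eqF //; exact: denom_gt0.
Qed.

(** Let [l0] be a shortest vector from an omitted logarithm to [log (p w0)] and
    [l] the local branch of [log p] that starts at [l0], so that [l w] is a vector
    to [log (p w)] from the same omitted point. The supporting map is
    [sqrt (l / C)]: the omitted point may cease to be the nearest one as [w]
    moves, and then the density is larger than the pull-back. *)
Lemma log_density_support w0 : unit_disk w0 -> poincare_support log_density w0.
Proof.
move=> wD; have [L [r r0 [L0 HL]]] := p_local_log wD.
have [l0 El0 l0E] := log_dist_attained E_closed (omitted_ne wD).
pose l w := l0 + L w.
have l_w0 : l w0 = l0 by rewrite /l L0 addr0.
have l0D : normc l0 < D by rewrite l0E; exact: dist_lt.
have l0_neq0 : l0 != 0 by rewrite -normc_gt0 l0E; exact: dist_gt0.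
have dl w : normc (w - w0) < r ->
    is_derive w (1 : cplx R) l ('D_1 p w / p w).
  move=> /HL[_ dL _]; rewrite -[X in is_derive _ _ _ X]add0r.
  by apply: (@is_deriveD _ _ _ (cst l0) L _ _ 0); exact: dL.
have dist_le w : normc (w - w0) < r -> dist w <= normc (l w).
  move=> /HL[_ _ pw]; apply: log_dist_le.
  by rewrite pw /l opprD cexpD mulrACA -cexpD subrr cexp0 mulr1.
have cl : {for w0, continuous l}.
  apply: cplx_derivable_continuous.
  by apply: (@ex_derive _ _ _ _ _ _ _ (dl w0 _)); rewrite subrr normc0.
have lD0 : 0 < D - normc l0 by rewrite subr_gt0.
have [r1 r10 Hr1] := (continuous_cplxP _ _).1 cl _ lD0.
have [||L2 [r2 r20 [r2r [L20 HL2]]]] := @local_log _ l w0 r r0.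
- by move=> w /dl dlw; exact: (@ex_derive _ _ _ _ _ _ _ dlw).
- by rewrite l_w0.
(* the root is written [k0 exp ((log (l / l0)) / 2)], to have it holomorphic *)
pose k0 : cplx R := sqrtC (l0 / mkc C 0).
pose k w := k0 * cexp (2^-1 * L2 w).
have C0' : mkc C 0 != 0.
  by rewrite -normc_gt0 normc_re ger0_norm ?ltW.
have kk w : normc (w - w0) < r2 -> k w ^+ 2 = l w / mkc C 0.
  move=> /HL2[_ _ EL2]; rewrite /k exprMn sqrtCK [cexp _ ^+ 2]expr2 -cexpD.
  have -> : 2^-1 * L2 w + 2^-1 * L2 w = L2 w by field.
  by rewrite EL2 l_w0; field; rewrite l0_neq0 C0'.
pose d := Num.min r2 r1.
have Hd w : normc (w - w0) < d -> [/\ normc (w - w0) < r2,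
    normc (w - w0) < r & normc (l w) < D].
  rewrite lt_min => /andP[w2 w1]; split=> //.
    exact: lt_le_trans r2r.
  by have := Hr1 _ w1; rewrite l_w0; have := normc_tri (l w) l0; lra.
have nk w : normc (w - w0) < r2 -> normc (k w) ^+ 2 = normc (l w) / C.
  by move=> /kk H; rewrite -normcX H normcf normc_re ger0_norm // ltW.
have nk' w : normc (w - w0) < r2 -> normc (k w) = Num.sqrt (normc (l w) / C).
  by move=> /nk <-; rewrite sqrtr_sqr ger0_norm // normc_ge0.
have dk w : normc (w - w0) < r2 ->
    is_derive w (1 : cplx R) k (k w * ('D_1 p w / p w / (2 * l w))).
  move=> w2; have wr := lt_le_trans w2 r2r.
  have [lw dL2 _] := HL2 _ w2.
  have DlE : 'D_1 l w = 'D_1 p w / p w.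
    exact: (@derive_val _ _ _ _ _ _ _ (dl _ wr)).
  have pw : p w != 0 by apply: p_neq0; have [] := HL w wr.
  have := is_derive_cmul k0 (is_derive_cplx_comp (is_derive_cmul 2^-1 dL2)
    (is_derive_cexp (2^-1 * L2 w))).
  congr (is_derive _ _ _ _); rewrite DlE /k; field.
  by rewrite lw pw.
have l_neq0 w : normc (w - w0) < r2 -> 0 < normc (l w).
  by move=> /HL2[lw _ _]; rewrite normc_gt0.
have densE w : normc (w - w0) < d ->
    normc ('D_1 k w) / (1 - normc (k w) ^+ 2) =
    normc ('D_1 p w) / (normc (p w) * (2 * C * sqrt_profile (normc (l w) / C))).
  move=> /Hd[w2 wr lD]; have lw := l_neq0 _ w2.
  rewrite (@derive_val _ _ _ _ _ _ _ (dk _ w2)) nk // normcM nk' //.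
  have [tE t0] : normc (l w) / C = normc (l w) / C /\ 0 < normc (l w) / C.
    by rewrite divr_gt0.
  set t := normc (l w) / C in tE t0 *.
  have -> : normc ('D_1 p w / p w / (2 * l w)) =
      normc ('D_1 p w) / normc (p w) / (2 * (t * C)).
    rewrite !normcf normcM /t divfK ?gt_eqF //.
    by rewrite normc_nat2.
  rewrite /sqrt_profile -[in t * C](sqr_sqrtr (ltW t0)).
  have pw : normc (p w) != 0.
    by rewrite gt_eqF // normc_gt0; apply: p_neq0; have [] := HL w wr.
  have t1 : 1 - t != 0.
    by rewrite gt_eqF // subr_gt0 ltr_pdivrMr // mul1r (lt_trans lD).
  have s0 : Num.sqrt t != 0 by rewrite gt_eqF // sqrtr_gt0.
  by field; rewrite pw s0 t1 gt_eqF.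
exists k, d; split.
- by rewrite lt_min r20.
- move=> w /Hd[w2 wr lD]; split.
    exact: (@ex_derive _ _ _ _ _ _ _ (dk _ w2)).
  rewrite nk' // -sqrtr1 ltr_sqrt // ltr_pdivrMr // mul1r.
  exact: lt_trans D_lt_C.
- move=> w wd; have [w2 wr lD] := Hd _ wd; rewrite densE //.
  have [wD' _ _] := HL _ wr.
  have le_prof : sqrt_profile (dist w / C) <= sqrt_profile (normc (l w) / C).
    apply: sqrt_profile_incr.
    - by rewrite divr_ge0 ?(ltW C0) // ltW // dist_gt0.
    - by rewrite ler_pM2r ?invr_gt0 //; exact: dist_le.
    - rewrite ler_pdivrMr // /C mulrA mul1r mulVf // mul1r.
      exact: ltW.
  have h0 := profile_gt0 wD'.
  have C2 : 0 < 2 * C by exact: mulr_gt0.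
  have pw0 : 0 < normc (p w) by rewrite normc_gt0 p_neq0.
  apply: ler_wpM2l; first exact: normc_ge0.
  rewrite lef_pV2 ?posrE; last 2 first.
  - exact: mulr_gt0 pw0 (mulr_gt0 C2 (lt_le_trans h0 le_prof)).
  - exact: denom_gt0.
  by rewrite ler_pM2l // ler_pM2l.
- by rewrite densE ?subrr ?normc0 ?lt_min ?r20 // l_w0 l0E.
Qed.

(** A holomorphic [p] on the disk that omits [E], with [log (p w)] always within
    [D] of [log E], has [log p] of hyperbolic derivative at most [12/5 D]. *)
Theorem log_landau w : unit_disk w ->
  normc ('D_1 p w) * (1 - normc w ^+ 2) <= 12 / 5 * D * normc (p w).
Proof.
move=> wD.
have := ahlfors_lemma continuous_log_density log_density_support wD.
have P0 := denom_gt0 wD.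
rewrite /log_density mulrAC ler_pdivrMr // mul1r => /le_trans; apply.
have t0 : 0 <= dist w / C by rewrite divr_ge0 ?ltW // dist_gt0.
have t1 : dist w / C <= 1.
  rewrite ler_pdivrMr // mul1r (le_trans (ltW (dist_lt wD))) // /C.
  by have := D0; lra.
rewrite mulrC; apply: ler_wpM2r; first exact: normc_ge0.
apply: le_trans (ler_wpM2l _ (sqrt_profile_le t0 t1)) _.
  by rewrite mulr_ge0 // ltW.
by rewrite /C; lra.
Qed.

End LogLandau.


(** * Hyperbolic density near a slowly decreasing sequence *)

Section NearestPoint.
Variables (R : realType).
Implicit Types (r : nat -> R) (x : R).

Lemma exists_max_seq r : (forall n, 0 < r n) -> r @ \oo --> 0 ->
  exists m, forall n, r n <= r m.
Proof.
move=> r0 /cvgrPdist_lt /(_ _ (r0 0%N)) [N _ HN].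
have far n : (N <= n)%N -> r n < r 0%N.
  by move=> /HN /=; rewrite sub0r normrN ger0_norm // ltW.
have [m Hm] : exists m, forall n, (n <= N)%N -> r n <= r m.
  elim: N {HN far} => [|N [m IH]].
    by exists 0%N => n; rewrite leqn0 => /eqP ->.
  have [le|/ltW le] := leP (r N.+1) (r m).
    by exists m => n; rewrite leq_eqVlt => /predU1P[->//|]; exact: IH.
  exists N.+1 => n; rewrite leq_eqVlt => /predU1P[->//|/IH nm].
  exact: le_trans nm le.
exists m => n; have [/Hm //|/ltnW/far/ltW r_n] := leqP n N.
by apply: le_trans r_n _; exact: Hm.
Qed.

(** If [x] is at least [r m], then [m] itself will do. Otherwise take the first
    index after [m] with [r n <= x]: the previous term exceeds [x], so that
    [x <= 2 * r n] by the ratio condition. The factors [r m < 1] let one statement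
    cover both cases. *)
Lemma exists_comparable r m x : (forall n, 0 < r n) -> r @ \oo --> 0 ->
  (forall n, 1 / 2 * r n <= r n.+1) -> 0 < x -> x < 1 -> r m < 1 ->
  exists n, r n * r m <= x <= 2 * r n / r m.
Proof.
move=> r0 rl rr x0 x1 rm1.
have [mx|xm] := leP (r m) x.
  exists m; apply/andP; split.
    by apply: le_trans mx; rewrite ler_piMl ?ltW.
  by rewrite mulfK ?gt_eqF // ltW // (lt_trans x1) // ltr1n.
have ex : exists n, r (m + n)%N <= x.
  move/cvgrPdist_lt: rl => /(_ _ x0) [N _ /(_ (m + N)%N)].
  rewrite /= leq_addl => /(_ isT); rewrite sub0r normrN ger0_norm ?ltW //.
  by move=> /ltW H; exists N.
case: (ex_minnP ex) => -[|n] Hn Hmin.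
  by move: xm; rewrite ltNge; rewrite addn0 in Hn; rewrite Hn.
have xn : x < r (m + n)%N.
  by rewrite ltNge; apply/negP => /Hmin; rewrite ltnn.
have := rr (m + n)%N; rewrite -addnS => rn.
exists (m + n.+1)%N; apply/andP; split.
  by apply: le_trans Hn; rewrite ler_piMr ?ltW.
rewrite ler_pdivlMr //; apply: (@le_trans _ _ x).
  by rewrite ler_piMr ?ltW.
by move: xn rn; clear; lra.
Qed.

End NearestPoint.

Section Main.
Variable R : realType.

Lemma sqrt2_ge : 6 / 5 <= Num.sqrt 2 :> R.
Proof.
rewrite -[leLHS]ger0_norm // -sqrtr_sqr ler_sqrt //; lra.
Qed.

Lemma kappa_gt4 : 4 < kappa R.
Proof.
rewrite /kappa ltrDl ln_gt0 //; have := sqrtr_ge0 (2 : R); lra.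
Qed.

(** The left side bounds the distance from [log z] to the logarithms of the
    sequence: [- ln d + ln 2] for the real part by [exists_comparable], and [pi]
    for the imaginary part. *)
Lemma log_radius (d : R) : 0 < d -> d < 1 ->
  - ln d + ln 2 + pi < kappa R + ln (4 / d).
Proof.
move=> d0 d1.
have -> : ln (4 / d) = ln 2 + ln 2 - ln d.
  by rewrite ln_div ?posrE // (_ : 4 = 2 * 2) ?lnM ?posrE //; ring.
have := kappa_gt4; have := pihalf_lt2 R.
have : 0 < ln 2 :> R by rewrite ln_gt0 // ltr1n.
lra.
Qed.

End Main.

Unset Implicit Arguments.

Theorem theorem1p1 (R : realType) (E : set (cplx R)) (a : nat -> cplx R)
    (lam : cplx R -> R)
    (E_compact : compact E)
    (E_disk : E `<=` @unit_disk R)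
    (a_E : forall n, E (a n))
    (a_inj : injective a)
    (a_neq0 : forall n, a n != 0)
    (a_lim : a @ \oo --> (0 : cplx R))
    (a_ratio : forall n, 1 / 2 * Normc.normc (a n) <= Normc.normc (a n.+1))
    (G_connected : connected (@unit_disk R `\` E))
    (G_boundary0 : boundary (@unit_disk R `\` E) 0)
    (lam_density : hyperbolic_density (@unit_disk R `\` E) lam) :
  (exists2 c : R, 0 < c &
     forall z, (@unit_disk R `\` E) z -> c / Normc.normc z <= lam z) /\
  (exists2 delta : R,
     is_maximum (range (fun n => Normc.normc (a n))) delta &
     0 < explicit_constant delta /\
     forall z, (@unit_disk R `\` E) z ->
       explicit_constant delta / Normc.normc z <= lam z).
Proof.
have Ecl : closed E by apply: compact_closed E_compact; exact: norm_hausdorff.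
have E0 : E 0.
  apply: (closed_cvg E Ecl _ _ a_lim); exact: nearW.
pose r n := normc (a n).
have r0 n : 0 < r n by rewrite normc_gt0.
have rl : r @ \oo --> 0.
  rewrite -(@normc0 R).
  exact: (@cvg_comp _ _ _ a (@normc R) _ _ _ a_lim (@continuous_normc R 0)).
have [m Hm] := exists_max_seq r0 rl.
pose delta := r m; have d0 : 0 < delta by exact: r0.
have d1 : delta < 1 by exact: E_disk (a_E m).
pose D := kappa R + ln (4 / delta).
have radius := log_radius d0 d1.
have ln2 : 0 < ln 2 :> R by rewrite ln_gt0 // ltr1n.
have lnd : ln delta < 0 by rewrite ln_lt0 // d0.
have D0 : 0 < D.
  by apply: lt_trans radius; have := pi_gt0 R; clear -ln2 lnd; lra.
have s2 := sqrt2_ge R.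
have s20 : 0 < 2 * Num.sqrt 2 :> R.
  by rewrite mulr_gt0 // (lt_le_trans _ s2) // divr_gt0.
have c1 : 0 < 1 / (2 * Num.sqrt 2 * D) by rewrite divr_gt0 // mulr_gt0.
have cst0 : 0 < explicit_constant delta.
  rewrite /explicit_constant lt_min -/D c1 /= divr_gt0 // mulr_gt0 //.
  by have := kappa_gt4 R; clear -ln2; lra.
have [p [hp [_ imp _]] lamE] := lam_density.
have pG w : unit_disk w -> (@unit_disk R `\` E) (p w).
  by move=> wD; rewrite -imp; exists w.
have near w : unit_disk w -> exists2 l, normc l < D & E (p w * cexp (- l)).
  move=> /pG [pwD pwE].
  have pw0 : p w != 0 by apply/eqP => pw; apply: pwE; rewrite pw.
  have n0 : 0 < normc (p w) by rewrite normc_gt0.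
  have [n /andP[lo hi]] := exists_comparable r0 rl a_ratio n0 pwD d1.
  have q0 : p w / a n != 0 by rewrite mulf_neq0 ?invr_neq0.
  have [t tpi tE] := polar_form q0.
  exists (mkc (ln (normc (p w / a n))) t); last first.
    by rewrite cexpN -tE invf_div mulrCA mulfV // mulr1.
  apply: le_lt_trans (normc_le_reim _) _; rewrite re_mkc im_mkc.
  apply: le_lt_trans radius; apply: lerD => //.
  have an0 := r0 n; have qn0 : 0 < normc (p w / a n) by rewrite normc_gt0.
  have h1 : ln delta <= ln (normc (p w / a n)).
    rewrite ler_ln ?posrE // normcf ler_pdivlMr //.
    by rewrite mulrC.
  have h2 : ln (normc (p w / a n)) <= ln 2 - ln delta.
    rewrite -ln_div ?posrE // ler_ln ?posrE ?divr_gt0 // normcf ler_pdivrMr //.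
    by rewrite mulrAC.
  by rewrite ler_norml; clear -h1 h2 ln2; lra.
have key z : (@unit_disk R `\` E) z ->
    explicit_constant delta / normc z <= lam z.
  move=> Gz; have [w wD pwz] : (p @` @unit_disk R) z by rewrite imp.
  rewrite -pwz in Gz *.
  have [pwD pwE] := Gz.
  have n0 : 0 < normc (p w).
    by rewrite normc_gt0; apply/eqP => pw; apply: pwE; rewrite pw.
  have := log_landau Ecl E0 D0 hp (fun w wD => (pG w wD).2) near wD.
  have := lamE _ wD; rewrite derive1E.
  set A := normc ('D_1 p w); set B := 1 - normc w ^+ 2 => lamA AB.
  have B0 : 0 < B.
    by rewrite subr_gt0 -(expr1n _ 2) ltrXn2r // ?normc_ge0 // ltW.
  have A0 : 0 < A.
    rewrite lt_def normc_ge0 andbT; apply/eqP => A0; move: lamA.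
    by rewrite A0 mulr0 => /esym/eqP; rewrite gt_eqF // divr_gt0.
  have -> : lam (p w) = 1 / (A * B).
    by rewrite -(mulfK (lt0r_neq0 A0) (lam (p w))) lamA; field; rewrite !gt_eqF.
  rewrite ler_pdivlMr ?mulr_gt0 // mulrAC ler_pdivrMr // mul1r.
  apply: (@le_trans _ _ (1 / (2 * Num.sqrt 2 * D) * (12 / 5 * D * normc (p w)))).
    apply: ler_pM => //; first exact: ltW.
    - by rewrite mulr_ge0 // ltW.
    - by rewrite /explicit_constant ge_min lexx.
  rewrite div1r ler_pdivrMl; last by rewrite mulr_gt0.
  rewrite ler_wpM2r ?(ltW n0) // ler_wpM2r ?(ltW D0) //.
  by clear -s2; lra.
split; first by exists (explicit_constant delta).
exists delta; last by split.
split; first by exists m.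
by move=> _ [n _ <-]; exact: Hm.
Qed.
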